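(* Suppose that $Q_k\ge 0$ and $Q_k+\bar Q_k\ge 0$ for all $k\in\{0,1,\dots,N\}$, and $R_k>0$ and $R_k+\bar R_k>0$ for all $k\in\{0,1,\dots,N-1\}$. Let matrices $P^x_k,\bar P^x_k,P^{xy}_k,\bar P^{xy}_k,P^y_k,\bar P^y_k\in\mathbb R^{n\times n}$ ($k=0,\dots,N$) be determined backwards in $k$ by $$P^x_N=Q_N,\ \bar P^x_N=\bar Q_N,\ P^{xy}_N=-Q_N,\ \bar P^{xy}_N=-\bar Q_N,\ P^y_N=Q_N,\ \bar P^y_N=\bar Q_N,$$ and, for $k=N-1,\dots,0$, $$\begin{aligned} P^x_k&=Q_k+A_k^TP^x_{k+1}A_k+C_k^TP^x_{k+1}C_k-H^{(1)}_k(W^{(1)}_k)^{-1}(H^{(1)}_k)^T,\\ P^x_k+\bar P^x_k&=Q_k+\bar Q_k+(A_k+\bar A_k)^T(P^x_{k+1}+\bar P^x_{k+1})(A_k+\bar A_k)+(C_k+\bar C_k)^TP^x_{k+1}(C_k+\bar C_k)\\&\quad-H^{(2)}_k(W^{(2)}_k)^{-1}(H^{(2)}_k)^T,\\ P^{xy}_k&=-Q_k+F_k^TP^{xy}_{k+1}A_k+\rho\,G_k^TP^{xy}_{k+1}C_k-H^{(3)}_k(W^{(1)}_k)^{-1}(H^{(1)}_k)^T,\\ P^{xy}_k+\bar P^{xy}_k&=-Q_k-\bar Q_k+(F_k+\bar F_k)^T(P^{xy}_{k+1}+\bar P^{xy}_{k+1})(A_k+\bar A_k)+\rho\,(G_k+\bar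 G_k)^TP^{xy}_{k+1}(C_k+\bar C_k)\\&\quad-H^{(4)}_k(W^{(2)}_k)^{-1}(H^{(2)}_k)^T,\\ P^y_k&=Q_k+F_k^TP^y_{k+1}F_k+G_k^TP^y_{k+1}G_k-H^{(3)}_k(W^{(1)}_k)^{-1}(H^{(3)}_k)^T,\\ P^y_k+\bar P^y_k&=Q_k+\bar Q_k+(F_k+\bar F_k)^T(P^y_{k+1}+\bar P^y_{k+1})(F_k+\bar F_k)+(G_k+\bar G_k)^TP^y_{k+1}(G_k+\bar G_k)\\&\quad-H^{(4)}_k(W^{(2)}_k)^{-1}(H^{(4)}_k)^T, \end{aligned}$$ where $$\begin{aligned} W^{(1)}_k&=R_k+B_k^TP^x_{k+1}B_k+D_k^TP^x_{k+1}D_k,\\ W^{(2)}_k&=R_k+\bar R_k+(B_k+\bar B_k)^T(P^x_{k+1}+\bar P^x_{k+1})(B_k+\bar B_k)+(D_k+\bar D_k)^TP^x_{k+1}(D_k+\bar D_k),\\ H^{(1)}_k&=A_k^TP^x_{k+1}B_k+C_k^TP^x_{k+1}D_k,\\ H^{(2)}_k&=(A_k+\bar A_k)^T(P^x_{k+1}+\bar P^x_{k+1})(B_k+\bar B_k)+(C_k+\bar C_k)^TP^x_{k+1}(D_k+\bar D_k),\\ H^{(3)}_k&=F_k^TP^{xy}_{k+1}B_k+\rho\,G_k^TP^{xy}_{k+1}D_k,\\ H^{(4)}_k&=(F_k+\bar F_k)^T(P^{xy}_{k+1}+\bar P^{xy}_{k+1})(B_k+\bar B_k)+\rho\,(G_k+\bar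 G_k)^TP^{xy}_{k+1}(D_k+\bar D_k). \end{aligned}$$ Then for any square-integrable $\zeta^x,\zeta^y$, among all controls of the linear feedback form $$u_k=L^x_kx_k+\bar L^x_k\mathbb Ex_k+L^y_ky_k+\bar L^y_k\mathbb Ey_k,\qquad L^x_k,\bar L^x_k,L^y_k,\bar L^y_k\in\mathbb R^{m\times n},\quad k=0,\dots,N-1,$$ the unique control minimizing $J(\zeta^x,\zeta^y,u)$ is $$u^o_k=-(W^{(1)}_k)^{-1}(H^{(1)}_k)^T(x_k-\mathbb Ex_k)-(W^{(2)}_k)^{-1}(H^{(2)}_k)^T\mathbb Ex_k-(W^{(1)}_k)^{-1}(H^{(3)}_k)^T(y_k-\mathbb Ey_k)-(W^{(2)}_k)^{-1}(H^{(4)}_k)^T\mathbb Ey_k,$$ $k=0,\dots,N-1$, and moreover $P^x_k\ge 0$ and $P^x_k+\bar P^x_k\ge 0$ for all $k\in\{0,\dots,N\}$.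
   Context: $N$ is a positive integer. Given are deterministic matrices $A_k,\bar A_k,C_k,\bar C_k,F_k,\bar F_k,G_k,\bar G_k\in\mathbb R^{n\times n}$ and $B_k,\bar B_k,D_k,\bar D_k\in\mathbb R^{n\times m}$ ($0\le k\le N-1$), deterministic symmetric matrices $Q_k,\bar Q_k\in\mathbb R^{n\times n}$ ($0\le k\le N$) and $R_k,\bar R_k\in\mathbb R^{m\times m}$ ($0\le k\le N-1$), and a constant $\rho\in\mathbb R$. $\mathbb E$ denotes expectation. For symmetric $M$, $M\ge0$ (resp. $M>0$) means positive semidefinite (resp. positive definite). On a probability space $(\Omega,\mathcal F,P)$ let $\zeta^x,\zeta^y$ be square-integrable $\mathbb R^n$-valued random vectors and $(w_k)_{0\le k\le N-1},(v_k)_{0\le k\le N-1}$ real random variables. Let $\mathcal F_k$ be the $\sigma$-algebra generated by $\zeta^x,\zeta^y$ and $w_l,v_l$, $0\le l\le k-1$ (the information available before $w_k,v_k$ are realized), and assume $$\mathbb E[w_k|\mathcal F_k]=\mathbb E[v_k|\mathcal F_k]=0,\quad \mathbb E[w_k^2|\mathcal F_k]=\mathbb E[v_k^2|\mathcal F_k]=1,\quad \mathbb E[w_kv_k|\mathcal F_k]=\rho .$$ The system is, for $k=0,\dots,N-1$, $$x_{k+1}=(A_kx_k+\bar A_k\mathbb Ex_k+B_ku_k+\bar B_k\mathbb Eu_k)+(C_kx_k+\bar C_k\mathbb Ex_k+D_ku_k+\bar D_k\mathbb Eu_k)w_k,$$ $$y_{k+1}=(F_ky_k+\bar F_k\mathbb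 Ey_k)+(G_ky_k+\bar G_k\mathbb Ey_k)v_k,\qquad x_0=\zeta^x,\ y_0=\zeta^y.$$ The cost functional is $$J(\zeta^x,\zeta^y,u)=\sum_{k=0}^{N-1}\mathbb E\Big((x_k-y_k)^TQ_k(x_k-y_k)+u_k^TR_ku_k+(\mathbb E(x_k-y_k))^T\bar Q_k\mathbb E(x_k-y_k)+(\mathbb Eu_k)^T\bar R_k\mathbb Eu_k\Big)$$ $$\qquad+\mathbb E\big((x_N-y_N)^TQ_N(x_N-y_N)\big)+(\mathbb E(x_N-y_N))^T\bar Q_N\mathbb E(x_N-y_N).$$ Controls are identified when they are almost surely equal. *)

(* Defs.v *)
From HB Require Import structures.
From mathcomp Require Import all_boot all_order all_algebra.
From mathcomp Require Import all_classical all_reals all_analysis.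

Set Implicit Arguments.
Unset Strict Implicit.
Unset Printing Implicit Defensive.

Import Order.TTheory GRing.Theory Num.Theory.
Import numFieldNormedType.Exports.

Local Open Scope classical_set_scope.
Local Open Scope ring_scope.

Section Definiteness.
Context {R : realType} {n : nat}.

Definition quad (M : 'M[R]_n) (z : 'cV[R]_n) : R := (z^T *m M *m z) ord0 ord0.

Definition psd (M : 'M[R]_n) : Prop :=
  M \is symmetricmx /\ forall z : 'cV[R]_n, 0 <= quad M z.

Definition pd (M : 'M[R]_n) : Prop :=
  M \is symmetricmx /\ forall z : 'cV[R]_n, z != 0 -> 0 < quad M z.

End Definiteness.

Section Probability.
Context {R : realType} {d : measure_display} {T : measurableType d}.
Variable P : probability T R.

(* [Y] is a version of the conditional expectation of [X] given the
   sub-sigma-algebra [G]. *)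
Definition is_cond_expectation (G : set (set T)) (X Y : T -> R) : Prop :=
  [/\ P.-integrable setT (EFin \o X),
      P.-integrable setT (EFin \o Y),
      preimage_set_system setT Y measurable `<=` G
    & forall A, G A ->
        (\int[P]_(t in A) (X t)%:E = \int[P]_(t in A) (Y t)%:E)%E].

Definition square_integrable {n : nat} (X : T -> 'cV[R]_n) : Prop :=
  forall i : 'I_n, (fun t => X t i ord0) \in Lfun P 2%:E.

(* The sigma-algebra generated by zx, zy and w_l, v_l for l < k; the vectors
   enter through their coordinates, which generate the Borel sets of R^n. *)
Definition filtration {n : nat} (zx zy : T -> 'cV[R]_n) (w v : nat -> T -> R)
    (k : nat) : set (set T) :=
  <<s (\bigcup_(i in [set: 'I_n])
         (preimage_set_system setT (fun t => zx t i ord0) measurable `|`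
          preimage_set_system setT (fun t => zy t i ord0) measurable)) `|`
      (\bigcup_(l in [set l | (l < k)%N])
         (preimage_set_system setT (w l) measurable `|`
          preimage_set_system setT (v l) measurable)) >>.

Definition noise_model {n : nat} (N : nat) (rho : R) (zx zy : T -> 'cV[R]_n)
    (w v : nat -> T -> R) : Prop :=
  forall k, (k < N)%N ->
  let Fk := filtration zx zy w v k in
  [/\ is_cond_expectation Fk (w k) (cst 0),
      is_cond_expectation Fk (v k) (cst 0),
      is_cond_expectation Fk (fun t => w k t ^+ 2) (cst 1),
      is_cond_expectation Fk (fun t => v k t ^+ 2) (cst 1)
    & is_cond_expectation Fk (fun t => w k t * v k t) (cst rho)].

Definition mean {n : nat} (X : T -> 'cV[R]_n) : 'cV[R]_n :=
  \col_i fine ('E_P[fun t => X t i ord0])%E.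

End Probability.

(* Coefficients are indexed by all of nat; only the indices k < N (k <= N for
   the state weights cQ, cQb) are ever used.  The suffix b stands for a bar. *)
Record coefficients (R : realType) (n m : nat) := Coefficients {
  mA : nat -> 'M[R]_n;      mAb : nat -> 'M[R]_n;
  mB : nat -> 'M[R]_(n, m); mBb : nat -> 'M[R]_(n, m);
  mC : nat -> 'M[R]_n;      mCb : nat -> 'M[R]_n;
  mD : nat -> 'M[R]_(n, m); mDb : nat -> 'M[R]_(n, m);
  mF : nat -> 'M[R]_n;      mFb : nat -> 'M[R]_n;
  mG : nat -> 'M[R]_n;      mGb : nat -> 'M[R]_n;
  cQ : nat -> 'M[R]_n;      cQb : nat -> 'M[R]_n;
  cR : nat -> 'M[R]_m;      cRb : nat -> 'M[R]_m
}.

Section System.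
Context {R : realType} {d : measure_display} {T : measurableType d}.
Context {n m : nat}.
Variables (P : probability T R) (K : coefficients R n m).
Variables (w v : nat -> T -> R) (zx zy : T -> 'cV[R]_n).

Fixpoint state_x (u : nat -> T -> 'cV[R]_m) (k : nat) : T -> 'cV[R]_n :=
  match k with
  | 0 => zx
  | j.+1 => fun t =>
      let x := state_x u j in
      (mA K j *m x t + mAb K j *m mean P x
        + mB K j *m u j t + mBb K j *m mean P (u j))
      + w j t *: (mC K j *m x t + mCb K j *m mean P x
        + mD K j *m u j t + mDb K j *m mean P (u j))
  end.

Fixpoint state_y (k : nat) : T -> 'cV[R]_n :=
  match k with
  | 0 => zy
  | j.+1 => fun t =>
      let y := state_y j in
      (mF K j *m y t + mFb K j *m mean P y)
      + v j t *: (mG K j *m y t + mGb K j *m mean P y)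
  end.

Definition tracking_error (u : nat -> T -> 'cV[R]_m) (k : nat) (t : T) :
    'cV[R]_n :=
  state_x u k t - state_y k t.

Definition cost (N : nat) (u : nat -> T -> 'cV[R]_m) : \bar R :=
  (\sum_(k < N)
     'E_P[fun t => (quad (cQ K k) (tracking_error u k t)
                    + quad (cR K k) (u k t)
                    + quad (cQb K k) (mean P (tracking_error u k))
                    + quad (cRb K k) (mean P (u k)))%R]
   + 'E_P[fun t => quad (cQ K N) (tracking_error u N t)]
   + (quad (cQb K N) (mean P (tracking_error u N)))%:E)%E.

Definition linear_feedback (N : nat) (u : nat -> T -> 'cV[R]_m) : Prop :=
  exists Lx Lxb Ly Lyb : nat -> 'M[R]_(m, n),
  forall k, (k < N)%N -> forall t,
    u k t = Lx k *m state_x u k t + Lxb k *m mean P (state_x u k)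
          + Ly k *m state_y k t + Lyb k *m mean P (state_y k).

Definition minimizes_cost (N : nat) (u : nat -> T -> 'cV[R]_m) : Prop :=
  linear_feedback N u /\
  forall u', linear_feedback N u' -> (cost N u <= cost N u')%E.

End System.

Record riccati_matrices (R : realType) (n : nat) := RiccatiMatrices {
  Px  : nat -> 'M[R]_n; Pxb  : nat -> 'M[R]_n;
  Pxy : nat -> 'M[R]_n; Pxyb : nat -> 'M[R]_n;
  Py  : nat -> 'M[R]_n; Pyb  : nat -> 'M[R]_n
}.

Section Riccati.
Context {R : realType} {n m : nat}.
Variables (K : coefficients R n m) (rho : R) (M : riccati_matrices R n).

Definition W1 (k : nat) : 'M[R]_m :=
  cR K k + (mB K k)^T *m Px M k.+1 *m mB K k
         + (mD K k)^T *m Px M k.+1 *m mD K k.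

Definition W2 (k : nat) : 'M[R]_m :=
  cR K k + cRb K k
  + (mB K k + mBb K k)^T *m (Px M k.+1 + Pxb M k.+1) *m (mB K k + mBb K k)
  + (mD K k + mDb K k)^T *m Px M k.+1 *m (mD K k + mDb K k).

Definition H1 (k : nat) : 'M[R]_(n, m) :=
  (mA K k)^T *m Px M k.+1 *m mB K k + (mC K k)^T *m Px M k.+1 *m mD K k.

Definition H2 (k : nat) : 'M[R]_(n, m) :=
  (mA K k + mAb K k)^T *m (Px M k.+1 + Pxb M k.+1) *m (mB K k + mBb K k)
  + (mC K k + mCb K k)^T *m Px M k.+1 *m (mD K k + mDb K k).

Definition H3 (k : nat) : 'M[R]_(n, m) :=
  (mF K k)^T *m Pxy M k.+1 *m mB K k
  + rho *: ((mG K k)^T *m Pxy M k.+1 *m mD K k).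

Definition H4 (k : nat) : 'M[R]_(n, m) :=
  (mF K k + mFb K k)^T *m (Pxy M k.+1 + Pxyb M k.+1) *m (mB K k + mBb K k)
  + rho *: ((mG K k + mGb K k)^T *m Pxy M k.+1 *m (mD K k + mDb K k)).

(* invmx is the identity on singular matrices, so the equations below always
   have exactly one solution; invertibility of W1 and W2 is to be proved. *)
Definition riccati_terminal (N : nat) : Prop :=
  [/\ Px M N = cQ K N /\ Pxb M N = cQb K N,
      Pxy M N = - cQ K N /\ Pxyb M N = - cQb K N
    & Py M N = cQ K N /\ Pyb M N = cQb K N].

Definition riccati_step_x (k : nat) : Prop :=
  Px M k =
    cQ K k + (mA K k)^T *m Px M k.+1 *m mA K k
    + (mC K k)^T *m Px M k.+1 *m mC K k
    - H1 k *m invmx (W1 k) *m (H1 k)^T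
  /\
  Px M k + Pxb M k =
    cQ K k + cQb K k
    + (mA K k + mAb K k)^T *m (Px M k.+1 + Pxb M k.+1) *m (mA K k + mAb K k)
    + (mC K k + mCb K k)^T *m Px M k.+1 *m (mC K k + mCb K k)
    - H2 k *m invmx (W2 k) *m (H2 k)^T.

Definition riccati_step_xy (k : nat) : Prop :=
  Pxy M k =
    - cQ K k + (mF K k)^T *m Pxy M k.+1 *m mA K k
    + rho *: ((mG K k)^T *m Pxy M k.+1 *m mC K k)
    - H3 k *m invmx (W1 k) *m (H1 k)^T
  /\
  Pxy M k + Pxyb M k =
    - cQ K k - cQb K k
    + (mF K k + mFb K k)^T *m (Pxy M k.+1 + Pxyb M k.+1) *m (mA K k + mAb K k)
    + rho *: ((mG K k + mGb K k)^T *m Pxy M k.+1 *m (mC K k + mCb K k))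
    - H4 k *m invmx (W2 k) *m (H2 k)^T.

Definition riccati_step_y (k : nat) : Prop :=
  Py M k =
    cQ K k + (mF K k)^T *m Py M k.+1 *m mF K k
    + (mG K k)^T *m Py M k.+1 *m mG K k
    - H3 k *m invmx (W1 k) *m (H3 k)^T
  /\
  Py M k + Pyb M k =
    cQ K k + cQb K k
    + (mF K k + mFb K k)^T *m (Py M k.+1 + Pyb M k.+1) *m (mF K k + mFb K k)
    + (mG K k + mGb K k)^T *m Py M k.+1 *m (mG K k + mGb K k)
    - H4 k *m invmx (W2 k) *m (H4 k)^T.

Definition riccati_system (N : nat) : Prop :=
  riccati_terminal N /\
  forall k, (k < N)%N ->
    [/\ riccati_step_x k, riccati_step_xy k & riccati_step_y k].

End Riccati.

(* Main.v *)
(** Split states and control into means and fluctuations.  Since the noises are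
    conditionally centered with second moments [1], [1], [rho], the expected
    quadratic form of the next state separates into a form in the current
    fluctuations and one in the current means; completing the square in each
    gives, for every linear feedback control [u],
      J(u) = V_0 + sum_k (E q1_k(u_k - E u_k - U_k) + q2_k(E u_k - M_k)),
    where [V_0] depends only on the initial states, [q1_k], [q2_k] are the
    positive definite forms of [W1_k], [W2_k] and [U_k], [M_k] are the fluctuation
    and the mean of the optimal control at the current state. *)

Require Import Defs.
From HB Require Import structures.
From mathcomp Require Import all_boot all_order all_algebra.
From mathcomp Require Import all_classical all_reals all_analysis.
From mathcomp Require Import measurable_realfun ring lra.

Set Implicit Arguments.
Unset Strict Implicit.
Unset Printing Implicit Defensive.

Import Order.TTheory GRing.Theory Num.Theory.
Import numFieldNormedType.Exports.

Local Open Scope classical_set_scope.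
Local Open Scope ring_scope.

(** * Expectations and conditional moments *)

Section Expectation.
Context {R : realType} {d : measure_display} {T : measurableType d}.
Variable P : probability T R.
Implicit Types (f g : T -> R) (c : R).

(** The conditional moments are given only as integrals over the sets of F_k, whereas expanding a
    form of the next state needs E(f w_k) = 0, E(f w_k v_k) = rho E f and the like for every
    integrable F_k-measurable f, together with the integrability of these products: f need not be
    bounded, and no noise moments beyond the second are assumed. Simple functions and monotone
    convergence give this for nonnegative factors; w_k, v_k and w_k v_k are differences of such
    factors. The second obstacle is that fluctuations and means are coupled: the noise multiplies
    the whole diffusion term, mean included, so the mean diffusion feeds the next fluctuation. It
    leaves a deterministic form weighted by P_{k+1}, not by P_{k+1} + Pbar_{k+1}, which joins the
    square completed in the means. Hence both weights occur in [W2], [H2] and [H4]. *)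

Definition ex f : R := fine 'E_P[f]%E.

Lemma Lfun_measurable p f : f \in Lfun P p -> measurable_fun setT f.
Proof. by move=> /sub_Lfun_mfun; rewrite inE. Qed.

Lemma integrable_Lfun1 f : P.-integrable setT (EFin \o f) -> f \in Lfun P 1.
Proof. by move/Lfun1_integrable. Qed.

Lemma ex_EFin f : f \in Lfun P 1 -> 'E_P[f]%E = (ex f)%:E.
Proof. by move=> lf; rewrite /ex fineK// expectation_fin_num. Qed.

Lemma Lfun1D f g : f \in Lfun P 1 -> g \in Lfun P 1 ->
  (fun t => f t + g t) \in Lfun P 1.
Proof. by move=> lf lg; exact: (@rpredD _ (Lfun P 1) _ _ lf lg). Qed.

Lemma Lfun1N f : f \in Lfun P 1 -> (fun t => - f t) \in Lfun P 1.
Proof. by move=> lf; rewrite -[X in X \in _]/(- f) rpredN. Qed.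

Lemma Lfun1B f g : f \in Lfun P 1 -> g \in Lfun P 1 ->
  (fun t => f t - g t) \in Lfun P 1.
Proof. by move=> lf lg; apply: Lfun1D => //; exact: Lfun1N. Qed.

Lemma Lfun1Z c f : f \in Lfun P 1 -> (fun t => c * f t) \in Lfun P 1.
Proof.
move=> /Lfun1_integrable lf; apply/integrable_Lfun1.
by have := integrableZl measurableT c lf.
Qed.

Lemma Lfun1_sum (I : Type) (s : seq I) (F : I -> T -> R) :
  (forall i, F i \in Lfun P 1) -> (fun t => \sum_(i <- s) F i t) \in Lfun P 1.
Proof.
move=> lF; elim: s => [|i s ih].
  by under eq_fun do rewrite big_nil; exact: Lfun_cst.
by under eq_fun do rewrite big_cons; exact: Lfun1D.
Qed.

Lemma exD f g : f \in Lfun P 1 -> g \in Lfun P 1 ->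
  ex (fun t => f t + g t) = ex f + ex g.
Proof.
by move=> lf lg; rewrite /ex expectationD// fineD// expectation_fin_num.
Qed.

Lemma exB f g : f \in Lfun P 1 -> g \in Lfun P 1 ->
  ex (fun t => f t - g t) = ex f - ex g.
Proof.
by move=> lf lg; rewrite /ex expectationB// fineB// expectation_fin_num.
Qed.

Lemma exZ c f : f \in Lfun P 1 -> ex (fun t => c * f t) = c * ex f.
Proof.
move=> lf; rewrite /ex [X in 'E_P[X]%E](_ : _ = c \o* f); last first.
  by apply/funext => t; rewrite /= mulrC.
by rewrite expectationZl// fineM// expectation_fin_num.
Qed.

Lemma ex_cst c : ex (fun=> c) = c.
Proof. by rewrite /ex expectation_cst. Qed.

Lemma ex_ge0 f : (forall t, 0 <= f t) -> 0 <= ex f.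
Proof. by move=> f0; rewrite /ex fine_ge0// expectation_ge0. Qed.

Lemma ex_ge0_eq0 f : f \in Lfun P 1 -> (forall t, 0 <= f t) -> ex f = 0 ->
  {ae P, forall t, f t = 0}.
Proof.
move=> lf f0 f_eq0.
have mf : measurable_fun setT (EFin \o f).
  by apply/measurable_EFinP; exact: Lfun_measurable lf.
have : (\int[P]_t `|(EFin \o f) t| = 0)%E.
  under eq_integral do rewrite gee0_abs ?lee_fin//.
  by have := ex_EFin lf; rewrite f_eq0 unlock.
move=> /(ae_eq_integral_abs P measurableT mf).
by apply: filterS => t /(_ I)[].
Qed.

Lemma Lfun2P f : f \in Lfun P 2%:E <->
  measurable_fun setT f /\ (fun t => f t ^+ 2) \in Lfun P 1.
Proof.
split=> [lf|[mf /Lfun1_integrable/integrableP[_ lf]]].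
  split; last by apply/integrable_Lfun1; exact: Lfun2_integrable_sqr.
  exact: Lfun_measurable lf.
rewrite inE; apply/andP; split; rewrite inE//=.
rewrite /finite_norm unlock /= poweR_lty//.
move: lf; congr (_ < _)%E; apply: eq_integral => t _ /=.
by rewrite powR_mulrn// normrX.
Qed.

Lemma Lfun2M f g : f \in Lfun P 2%:E -> g \in Lfun P 2%:E ->
  (fun t => f t * g t) \in Lfun P 1.
Proof. exact: Lfun2_mul_Lfun1. Qed.

Lemma Lfun2D f g : f \in Lfun P 2%:E -> g \in Lfun P 2%:E ->
  (fun t => f t + g t) \in Lfun P 2%:E.
Proof.
by move=> lf lg; rewrite -[X in X \in _]/(f + g) rpredD ?lee1n.
Qed.

Lemma Lfun2Z c f : f \in Lfun P 2%:E -> (fun t => c * f t) \in Lfun P 2%:E.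
Proof.
move=> lf; rewrite (_ : (fun t => _) = c \o* f); last first.
  by apply/funext => t; rewrite /= mulrC.
by apply: Lfun_scale => //; rewrite ler1n.
Qed.

Lemma Lfun2_sum (I : Type) (s : seq I) (F : I -> T -> R) :
  (forall i, F i \in Lfun P 2%:E) ->
  (fun t => \sum_(i <- s) F i t) \in Lfun P 2%:E.
Proof.
move=> lF; elim: s => [|i s ih].
  by under eq_fun do rewrite big_nil; exact: Lfun_cst.
by under eq_fun do rewrite big_cons; exact: Lfun2D.
Qed.

Lemma Lfun2_Lfun1 f : f \in Lfun P 2%:E -> f \in Lfun P 1.
Proof. by apply: Lfun_subset12; exact: fin_num_measure. Qed.

End Expectation.

(** * Constant conditional moments and the pull-out property *)

Section ConditionalMoments.
Context {R : realType} {d : measure_display} {T : measurableType d}.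
Variables (P : probability T R) (G : set (set T)).
Hypothesis G_sub : <<s G >> `<=` @measurable d T.

(** Retyping T with the sigma-algebra generated by G makes the general results on measurable and
    simple functions available for the smaller sigma-algebra. *)
Definition sub_measurable (f : T -> R) : Prop :=
  measurable_fun [set: g_sigma_algebraType G] (f : g_sigma_algebraType G -> R).

Lemma sub_measurable_measurable (f : T -> R) :
  sub_measurable f -> measurable_fun setT f.
Proof. by move=> mf _ B mB; apply: G_sub; exact: mf. Qed.

Import HBNNSimple.

(** The hypothesis is the claim for indicators of sets in the generated sigma-algebra. Linearity
    extends it to simple functions, and monotone convergence on both sides to f. *)
Lemma ge0_integral_mul_sub_measurable (X f : T -> R) (c : R) :
    measurable_fun setT X -> (forall t, 0 <= X t) -> 0 <= c ->
    (forall A, <<s G >> A -> (\int[P]_(t in A) (X t)%:E = c%:E * P A)%E) ->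
    sub_measurable f -> (forall t, 0 <= f t) ->
  (\int[P]_t (f t * X t)%:E = c%:E * \int[P]_t (f t)%:E)%E.
Proof.
move=> mX X0 c0 XA mf f0.
have mfE := (@measurable_EFinP _ (g_sigma_algebraType G) _ _ f).2 mf.
have f0E x : [set: g_sigma_algebraType G] x -> (0 <= (f x)%:E)%E.
  by move=> _; rewrite lee_fin.
(* The approximation is built over the generated sigma-algebra, so that the level sets of each [h n]
   lie in it and [XA] applies to them. *)
pose h := nnsfun_approx measurableT mfE.
have mh n : measurable_fun [set: T] (h n : T -> R).
  by apply: sub_measurable_measurable; exact: measurable_funPT.
have hcvg := cvg_nnsfun_approx measurableT mfE f0E.
have hnd := nd_nnsfun_approx measurableT mfE.
have mhX n : measurable_fun [set: T] (fun t => h n t * X t).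
  exact: measurable_funM.
have h0 n t : 0 <= h n t by [].
have L : (\int[P]_t (f t)%:E = limn (fun n => \int[P]_t (h n t)%:E))%E.
  rewrite -monotone_convergence//.
  - by apply: eq_integral => t _; apply/esym/cvg_lim => //; exact: hcvg.
  - by move=> n; exact/measurable_EFinP.
  - by move=> n t _; rewrite lee_fin.
  - by move=> t _ a b ab; rewrite lee_fin; exact/lefP/hnd.
have LX : (\int[P]_t (f t * X t)%:E
    = limn (fun n => \int[P]_t (h n t * X t)%:E))%E.
  rewrite -monotone_convergence//.
  - apply: eq_integral => t _; apply/esym/cvg_lim => //.
    rewrite EFinM; under eq_fun do rewrite EFinM.
    by apply: cvgeZr => //; exact: hcvg.
  - by move=> n; exact/measurable_EFinP.
  - by move=> n t _; rewrite lee_fin mulr_ge0.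
  - by move=> t _ a b ab; rewrite lee_fin ler_wpM2r//; exact/lefP/hnd.
have hX n : (\int[P]_t (h n t * X t)%:E = c%:E * \int[P]_t (h n t)%:E)%E.
  pose A r : set T := h n @^-1` [set r].
  have sA r : <<s G >> (A r).
    have : @measurable _ (g_sigma_algebraType G) (A r).
      exact: measurable_sfunP.
    by [].
  have mA r : @measurable _ T (A r) by exact: G_sub.
  pose s := finmap.enum_fset (fset_set (range (h n))).
  (* The values r are nonnegative already; the absolute value makes every summand nonnegative
     without recalling that r is in the range of [h n]. *)
  have hE t : h n t = \sum_(r <- s) `|r| * \1_(A r) t.
    rewrite fimfunE fsbig_finite//= big_seq [RHS]big_seq.
    apply: eq_bigr => r; rewrite in_fset_set// => /set_mem[u _ <-].
    by rewrite ger0_norm.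
  have m1 r : measurable_fun [set: T] (\1_(A r) : T -> R) by [].
  have -> : (\int[P]_t (h n t)%:E = \sum_(r <- s) `|r|%:E * P (A r))%E.
    under eq_integral do rewrite hE -sumEFin.
    rewrite ge0_integral_sum//; last first.
      by move=> r; apply/measurable_EFinP; exact: measurable_funM.
    apply: eq_bigr => r _; under eq_integral do rewrite EFinM.
    rewrite ge0_integralZl_EFin// ?integral_indic// ?setIT//.
    exact/measurable_EFinP.
  have -> : (\int[P]_t (h n t * X t)%:E
      = \sum_(r <- s) `|r|%:E * (c%:E * P (A r)))%E.
    under eq_integral do rewrite hE mulr_suml -sumEFin.
    rewrite ge0_integral_sum//; last 2 first.
    - by move=> r; apply/measurable_EFinP; do 2 apply: measurable_funM => //.
    - by move=> r t _; rewrite lee_fin !mulr_ge0.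
    apply: eq_bigr => r _; under eq_integral do rewrite -mulrA EFinM.
    rewrite ge0_integralZl_EFin//.
    - rewrite -XA// [in RHS]integral_mkcond epatch_indic; congr (_ * _)%E.
      by apply: eq_integral => t _; rewrite mulrC EFinM.
    - by move=> t _; rewrite lee_fin mulr_ge0.
    - by apply/measurable_EFinP; exact: measurable_funM.
  rewrite ge0_sume_distrr; first by apply: eq_bigr => r _; rewrite muleCA.
  by move=> r _; rewrite mule_ge0.
rewrite LX L -limeMl//; first by congr (limn _); apply/funext => n; exact: hX.
apply: ereal_nondecreasing_is_cvgn => a b ab.
apply: ge0_le_integral => //.
- by move=> t _; rewrite lee_fin.
- exact/measurable_EFinP.
- exact/measurable_EFinP.
- by move=> t _; rewrite lee_fin; exact/lefP/hnd.
Qed.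

Definition cond_moment (X : T -> R) (c : R) : Prop :=
  P.-integrable setT (EFin \o X) /\
  forall A, <<s G >> A -> (\int[P]_(t in A) (X t)%:E = c%:E * P A)%E.

Lemma cond_expectation_moment (X : T -> R) (c : R) :
  is_cond_expectation P <<s G >> X (cst c) -> cond_moment X c.
Proof.
move=> [iX _ _ XA]; split=> // A GA.
by rewrite XA//= integral_cst//; exact: G_sub.
Qed.

Lemma cond_momentD (X Y : T -> R) (a b : R) : cond_moment X a ->
  cond_moment Y b -> cond_moment (fun t => X t + Y t) (a + b).
Proof.
move=> [iX XA] [iY YA]; split; first exact: (integrableD measurableT iX iY).
move=> A GA; have mA := G_sub GA.
have iXA : P.-integrable A (EFin \o X) by exact: integrableS iX.
have iYA : P.-integrable A (EFin \o Y) by exact: integrableS iY.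
under eq_integral do rewrite EFinD.
rewrite (integralD mA iXA iYA) XA// YA// EFinD muleDl//.
exact: fin_num_measure.
Qed.

Lemma cond_moment_cst (c : R) : cond_moment (cst c) c.
Proof.
split; first exact: finite_measure_integrable_cst.
by move=> A GA; rewrite (integral_cst P (G_sub GA) c%:E).
Qed.

(** The pull-out property of a factor whose conditional expectation is the constant c. Integrability
    of the product is part of the claim, since f and X are in general both unbounded. *)
Definition multiplier (X : T -> R) (c : R) : Prop :=
  forall f, sub_measurable f -> f \in Lfun P 1 ->
  (fun t => f t * X t) \in Lfun P 1 /\ ex P (fun t => f t * X t) = c * ex P f.

(** For nonnegative f the extended-real identity shows that the integral of f X is finite, hence
    that the product is integrable; a signed f is split into its positive and negative parts.
    Testing on the whole space gives c >= 0. *)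
Lemma ge0_multiplier (X : T -> R) (c : R) :
  (forall t, 0 <= X t) -> cond_moment X c -> multiplier X c.
Proof.
move=> X0 [iX XA].
have c0 : 0 <= c.
  rewrite -lee_fin -[c%:E]mule1 -(probability_setT P) -XA; last first.
    exact: (@measurableT _ (g_sigma_algebraType G)).
  by apply: integral_ge0 => t _; rewrite lee_fin.
have mX : measurable_fun setT X.
  exact/measurable_EFinP/(measurable_int _ iX).
have key f : sub_measurable f -> f \in Lfun P 1 -> (forall t, 0 <= f t) ->
    (fun t => f t * X t) \in Lfun P 1 /\
    ex P (fun t => f t * X t) = c * ex P f.
  move=> mf lf f0.
  have E := ge0_integral_mul_sub_measurable mX X0 c0 XA mf f0.
  have Ef : (\int[P]_t (f t)%:E = (ex P f)%:E)%E.
    by have := ex_EFin lf; rewrite unlock.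
  have lfX : (fun t => f t * X t) \in Lfun P 1.
    apply/integrable_Lfun1/integrableP; split.
      apply/measurable_EFinP; apply: measurable_funM => //.
      exact: sub_measurable_measurable.
    under eq_integral do rewrite /= ger0_norm ?mulr_ge0//.
    by rewrite E Ef -EFinM ltry.
  by split=> //; rewrite {1}/ex unlock E Ef.
move=> f mf lf.
have lf' := (Lfun1_integrable P f).1 lf.
have [lp ep] := key f^\+ (measurable_funrpos mf)
  (integrable_Lfun1 (integrable_funrpos measurableT lf'))
  (funrpos_ge0 f).
have [ln en] := key f^\- (measurable_funrneg mf)
  (integrable_Lfun1 (integrable_funrneg measurableT lf'))
  (funrneg_ge0 f).
have fE t : f t = f^\+ t - f^\- t by rewrite -[in LHS](funrposBneg f).
have -> : (fun t => f t * X t) = (fun t => f^\+ t * X t - f^\- t * X t).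
  by apply/funext => t; rewrite {1}fE mulrBl.
split; first exact: Lfun1B.
rewrite exB// ep en -mulrBr; congr (c * _).
rewrite -exB; first by congr (ex P _); apply/funext => t; rewrite -fE.
- exact/integrable_Lfun1/integrable_funrpos.
- exact/integrable_Lfun1/integrable_funrneg.
Qed.

Lemma multiplierB (X Y : T -> R) (a b : R) : multiplier X a ->
  multiplier Y b -> multiplier (fun t => X t - Y t) (a - b).
Proof.
move=> hX hY f mf lf; have [lX eX] := hX f mf lf; have [lY eY] := hY f mf lf.
have -> : (fun t => f t * (X t - Y t)) = (fun t => f t * X t - f t * Y t).
  by apply/funext => t; rewrite mulrBr.
by split; [exact: Lfun1B | rewrite exB// eX eY mulrBl].
Qed.

(* Adding [w^2 + 1], resp. [w^2 + v^2] below, turns the signed factor into a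
   nonnegative one. *)
Lemma noise_multiplier (w : T -> R) : cond_moment w 0 ->
  cond_moment (fun t => w t ^+ 2) 1 -> multiplier w 0.
Proof.
move=> mw mw2.
have m1 := cond_momentD mw2 (cond_moment_cst 1).
have h1 : multiplier (fun t => w t ^+ 2 + 1) (1 + 1).
  by apply: ge0_multiplier => // t; rewrite addr_ge0// sqr_ge0.
have h2 : multiplier (fun t => w t + (w t ^+ 2 + 1)) (0 + (1 + 1)).
  by apply: ge0_multiplier => [t|]; [nra | exact: cond_momentD].
have := multiplierB h2 h1; rewrite addrK.
by congr multiplier; apply/funext => t; rewrite addrK.
Qed.

Lemma noise_product_multiplier (w v : T -> R) (rho : R) :
  cond_moment (fun t => w t ^+ 2) 1 -> cond_moment (fun t => v t ^+ 2) 1 ->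
  cond_moment (fun t => w t * v t) rho ->
  multiplier (fun t => w t * v t) rho.
Proof.
move=> mw2 mv2 mwv.
have m1 := cond_momentD mw2 mv2.
have h1 : multiplier (fun t => w t ^+ 2 + v t ^+ 2) (1 + 1).
  by apply: ge0_multiplier => // t; rewrite addr_ge0// sqr_ge0.
have h2 : multiplier (fun t => w t * v t + (w t ^+ 2 + v t ^+ 2))
    (rho + (1 + 1)).
  by apply: ge0_multiplier => [t|]; [nra | exact: cond_momentD].
have := multiplierB h2 h1; rewrite addrK.
by congr multiplier; apply/funext => t; rewrite addrK.
Qed.

End ConditionalMoments.

(** * Completing the square *)

Section BilinearForms.
Context {R : realType}.

Definition bil {p q : nat} (M : 'M[R]_(p, q)) (a : 'cV[R]_p) (b : 'cV[R]_q) : R :=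
  (a^T *m M *m b) ord0 ord0.

Lemma quadE {n : nat} (M : 'M[R]_n) z : quad M z = bil M z z.
Proof. by []. Qed.

Section Laws.
Context {p q : nat}.
Implicit Types (M : 'M[R]_(p, q)) (a : 'cV[R]_p) (b : 'cV[R]_q) (c : R).

Lemma bilDl M a1 a2 b : bil M (a1 + a2) b = bil M a1 b + bil M a2 b.
Proof. by rewrite /bil linearD/= !mulmxDl mxE. Qed.

Lemma bilDr M a b1 b2 : bil M a (b1 + b2) = bil M a b1 + bil M a b2.
Proof. by rewrite /bil mulmxDr mxE. Qed.

Lemma bilZl M c a b : bil M (c *: a) b = c * bil M a b.
Proof. by rewrite /bil linearZ/= -!scalemxAl mxE. Qed.

Lemma bilZr M c a b : bil M a (c *: b) = c * bil M a b.
Proof. by rewrite /bil -scalemxAr mxE. Qed.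

Lemma bilNl M a b : bil M (- a) b = - bil M a b.
Proof. by rewrite -scaleN1r bilZl mulN1r. Qed.

Lemma bilNr M a b : bil M a (- b) = - bil M a b.
Proof. by rewrite -scaleN1r bilZr mulN1r. Qed.

Lemma bil0l M b : bil M 0 b = 0.
Proof. by rewrite -(scale0r 0) bilZl mul0r. Qed.

Lemma bil0r M a : bil M a 0 = 0.
Proof. by rewrite -(scale0r 0) bilZr mul0r. Qed.

Lemma bilD M1 M2 a b : bil (M1 + M2) a b = bil M1 a b + bil M2 a b.
Proof. by rewrite /bil mulmxDr mulmxDl mxE. Qed.

Lemma bilZ c M a b : bil (c *: M) a b = c * bil M a b.
Proof. by rewrite /bil -scalemxAr -scalemxAl mxE. Qed.

Lemma bilN M a b : bil (- M) a b = - bil M a b.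
Proof. by rewrite -scaleN1r bilZ mulN1r. Qed.

Lemma bil_sum M a b :
  bil M a b = \sum_i \sum_j M i j * (a i ord0 * b j ord0).
Proof.
rewrite /bil mxE exchange_big/=; apply: eq_bigr => j _.
rewrite mxE mulr_suml; apply: eq_bigr => i _.
by rewrite mxE mulrA [a i ord0 * _]mulrC.
Qed.

End Laws.

Lemma bil_tr {p q : nat} (M : 'M[R]_(p, q)) a b : bil M a b = bil M^T b a.
Proof. by rewrite /bil -[a^T *m M *m b]trmxK [LHS]mxE !trmx_mul trmxK mulmxA. Qed.

Lemma bil_mulmx {p q p' q' : nat} (M : 'M[R]_(p, q)) (A : 'M[R]_(p, p'))
    (B : 'M[R]_(q, q')) a b :
  bil M (A *m a) (B *m b) = bil (A^T *m M *m B) a b.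
Proof. by rewrite /bil trmx_mul !mulmxA. Qed.

Lemma symmetricmxP {n : nat} (M : 'M[R]_n) : M \is symmetricmx <-> M^T = M.
Proof.
rewrite is_hermitianmxE expr0 scale1r map_mx_id//.
by split=> [/eqP <-//|->].
Qed.

Lemma quadD {n : nat} (M : 'M[R]_n) a b : M^T = M ->
  quad M (a + b) = quad M a + 2 * bil M a b + quad M b.
Proof.
move=> sM; rewrite !quadE bilDl !bilDr (bil_tr M b a) sM; ring.
Qed.

Lemma pd_unitmx {n : nat} (M : 'M[R]_n) : pd M -> M \in unitmx.
Proof.
move=> [sM pM]; rewrite unitmxE unitfE; apply/negP => /det0P[v v0 vM].
have vT0 : v^T != 0 by apply: contra_neq v0 => /(congr1 trmx); rewrite trmxK trmx0.
by have := pM _ vT0; rewrite /quad trmxK vM mul0mx mxE ltxx.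
Qed.

Lemma pd_quad_ge0 {n : nat} (M : 'M[R]_n) z : pd M -> 0 <= quad M z.
Proof.
move=> [_ pM]; have [->|/pM/ltW//] := eqVneq z 0.
by rewrite quadE bil0l.
Qed.

Lemma pd_quad_eq0 {n : nat} (M : 'M[R]_n) z : pd M -> quad M z = 0 -> z = 0.
Proof.
move=> [_ pM] z0; apply/eqP/contraT => /pM.
by rewrite z0 ltxx.
Qed.

Lemma psd_congr {n p : nat} (M : 'M[R]_n) (A : 'M[R]_(n, p)) :
  psd M -> psd (A^T *m M *m A).
Proof.
move=> [/symmetricmxP sM pM]; split.
  by apply/symmetricmxP; rewrite !trmx_mul trmxK sM mulmxA.
by move=> z; rewrite quadE -bil_mulmx; exact: pM.
Qed.

Lemma pd_psdD {n : nat} (M1 M2 : 'M[R]_n) : pd M1 -> psd M2 -> pd (M1 + M2).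
Proof.
move=> [/symmetricmxP s1 p1] [/symmetricmxP s2 p2]; split.
  by apply/symmetricmxP; rewrite linearD/= s1 s2.
by move=> z z0; rewrite quadE bilD ltr_pwDl ?p1//; exact: p2.
Qed.

(** The quadratic form of the pair (x, y) with diagonal blocks [Px], [Py] and off-diagonal block r
    [Pxy]. The factor r is 1 for drifts and rho for diffusions, because the noise correlation
    reaches only the cross term. *)
Definition joint_form {n : nat} (r : R) (Px Pxy Py : 'M[R]_n) (x y : 'cV[R]_n) : R :=
  quad Px x + 2 * r * bil Pxy y x + quad Py y.

Lemma joint_form_diff {n : nat} (M : 'M[R]_n) x y : M^T = M ->
  joint_form 1 M (- M) M x y = quad M (x - y).
Proof.
move=> sM; rewrite /joint_form quadD// !quadE !(bilN, bilNl, bilNr).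
by rewrite (bil_tr M x y) sM; ring.
Qed.

(* The dynamic programming step, for the fluctuations and for the means alike:
   P1 weights the drift and P2 the diffusion of the next state, whose two noises
   have correlation rho. *)
Section CompleteSquare.
Context {n m : nat}.
Variables (rho : R) (A C F G Q P1x P1xy P1y P2x P2xy P2y : 'M[R]_n).
Variables (B D : 'M[R]_(n, m)) (S : 'M[R]_m).

Let W := S + B^T *m P1x *m B + D^T *m P2x *m D.
Let H := A^T *m P1x *m B + C^T *m P2x *m D.
Let H' := F^T *m P1xy *m B + rho *: (G^T *m P2xy *m D).

Hypotheses (Q_sym : Q^T = Q) (S_sym : S^T = S).
Hypotheses (P1x_sym : P1x^T = P1x) (P2x_sym : P2x^T = P2x).
Hypothesis W_unit : W \in unitmx.

Let W_sym : W^T = W.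
Proof.
by rewrite /W !linearD/= !trmx_mul !trmxK S_sym P1x_sym P2x_sym !mulmxA.
Qed.

(** The terms linear in u are 2 h^T u with h = H^T x + H'^T y, so the square is centered at -W^{-1}
    h. The remainder -h^T W^{-1} h, expanded in x and y, yields exactly the three corrections in the
    Riccati equations. *)
Lemma complete_square (x y : 'cV[R]_n) (u : 'cV[R]_m) :
  quad Q (x - y) + quad S u
    + joint_form 1 P1x P1xy P1y (A *m x + B *m u) (F *m y)
    + joint_form rho P2x P2xy P2y (C *m x + D *m u) (G *m y)
  = quad W (u + invmx W *m (H^T *m x + H'^T *m y))
    + joint_form 1
        (Q + A^T *m P1x *m A + C^T *m P2x *m C - H *m invmx W *m H^T)
        (- Q + F^T *m P1xy *m A + rho *: (G^T *m P2xy *m C)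
           - H' *m invmx W *m H^T)
        (Q + F^T *m P1y *m F + G^T *m P2y *m G - H' *m invmx W *m H'^T)
        x y.
Proof.
have i_sym : (invmx W)^T = invmx W by rewrite trmx_inv W_sym.
set h := H^T *m x + H'^T *m y.
have -> : quad W (u + invmx W *m h)
    = quad W u + 2 * (bil H x u + bil H' y u) + quad (invmx W) h.
  rewrite quadD//; congr (_ + _ * _ + _).
    rewrite -[in LHS](mul1mx u) bil_mulmx trmx1 mul1mx mulmxV//.
    rewrite bil_tr trmx1 /h bilDl.
    by rewrite -[X in bil _ _ X + bil _ _ X](mul1mx u) !bil_mulmx !trmxK !mulmx1.
  by rewrite !quadE bil_mulmx i_sym mulVmx// mul1mx.
have -> : quad (invmx W) h = bil (H *m invmx W *m H^T) x x
    + 2 * bil (H' *m invmx W *m H^T) y x + bil (H' *m invmx W *m H'^T) y y.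
  rewrite quadD// !quadE !bil_mulmx !trmxK.
  by rewrite (bil_tr (H *m invmx W *m H'^T)) !trmx_mul !trmxK i_sym mulmxA.
rewrite /joint_form !(quadD _ _ P1x_sym) !(quadD _ _ P2x_sym) (quadD _ _ Q_sym).
rewrite !quadE !(bilDr, bilNl, bilNr) !bil_mulmx /W /H /H' !(bilD, bilN, bilZ).
rewrite (bil_tr Q x y) Q_sym.
ring.
Qed.

End CompleteSquare.

Lemma pd_complete_square {n m : nat} (P1x P2x : 'M[R]_n) (B D : 'M[R]_(n, m))
    (S : 'M[R]_m) : pd S -> psd P1x -> psd P2x ->
  pd (S + B^T *m P1x *m B + D^T *m P2x *m D).
Proof.
move=> pS p1 p2; apply: pd_psdD; last exact: psd_congr.
by apply: pd_psdD => //; exact: psd_congr.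
Qed.

(** At z, the resulting form is the minimum over u of a sum of nonnegative forms, and the minimum is
    attained. *)
Lemma psd_complete_square {n m : nat} (A C Q P1x P2x : 'M[R]_n)
    (B D : 'M[R]_(n, m)) (S : 'M[R]_m) :
    let W := S + B^T *m P1x *m B + D^T *m P2x *m D in
    let H := A^T *m P1x *m B + C^T *m P2x *m D in
    psd Q -> pd S -> psd P1x -> psd P2x ->
  psd (Q + A^T *m P1x *m A + C^T *m P2x *m C - H *m invmx W *m H^T).
Proof.
move=> W H pQ pS p1 p2.
have pW : pd W by exact: pd_complete_square.
have W_sym : W^T = W by apply/symmetricmxP; exact: pW.1.
have [Q_sym S_sym P1x_sym P2x_sym] :
    [/\ Q^T = Q, S^T = S, P1x^T = P1x & P2x^T = P2x].
  by split; apply/symmetricmxP; [exact: pQ.1|exact: pS.1|exact: p1.1|exact: p2.1].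
split.
  have sH : (H *m invmx W *m H^T)^T = H *m invmx W *m H^T.
    by rewrite trmx_mul trmxK trmx_mul trmx_inv W_sym mulmxA.
  apply/symmetricmxP; rewrite linearB/= sH !linearD/= !trmx_mul !trmxK.
  by rewrite Q_sym P1x_sym P2x_sym !mulmxA.
(* With y = 0, all data of y zero and u the minimizer, the completed square vanishes and the
   identity leaves only the form in question. *)
move=> z; pose u := - (invmx W *m (H^T *m z)).
have := complete_square 0 A C 0 0 0 0 0 0 Q_sym S_sym P1x_sym P2x_sym
  (pd_unitmx pW) z 0 u.
rewrite /joint_form !(mulmx0, addr0, subr0, bil0l, bil0r, quadE, mulr0).
rewrite [X in bil W X]addNr bil0l add0r => <-.
apply: addr_ge0; last exact: p2.2.
apply: addr_ge0; last exact: p1.2.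
by apply: addr_ge0; [exact: pQ.2 | exact: pd_quad_ge0].
Qed.

End BilinearForms.

(** * Adapted square-integrable vectors *)

Section SubMeasurable.
Context {R : realType} {d : measure_display} {T : measurableType d}.
Variable G : set (set T).
Implicit Types f g : T -> R.

Lemma sub_measurable_cst (c : R) : sub_measurable G (fun=> c : R).
Proof. exact: measurable_cst. Qed.

Lemma sub_measurableD f g : sub_measurable G f -> sub_measurable G g ->
  sub_measurable G (fun t => f t + g t).
Proof. exact: measurable_funD. Qed.

Lemma sub_measurableM f g : sub_measurable G f -> sub_measurable G g ->
  sub_measurable G (fun t => f t * g t).
Proof. exact: measurable_funM. Qed.

Lemma sub_measurable_sum (I : Type) (s : seq I) (F : I -> T -> R) :
  (forall i, sub_measurable G (F i)) ->
  sub_measurable G (fun t => \sum_(i <- s) F i t).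
Proof.
move=> mF; elim: s => [|i s ih].
  by under eq_fun do rewrite big_nil; exact: sub_measurable_cst.
by under eq_fun do rewrite big_cons; exact: sub_measurableD.
Qed.

Lemma sub_measurable_generator f :
  preimage_set_system setT f measurable `<=` G -> sub_measurable G f.
Proof. by move=> fG _ B mB; apply: sub_sigma_algebra; apply: fG; exists B. Qed.

Lemma sub_measurable_mono (G' : set (set T)) f :
  G `<=` G' -> sub_measurable G f -> sub_measurable G' f.
Proof.
move=> GG' mf _ B mB; have := mf measurableT B mB.
exact: sub_sigma_algebra2.
Qed.

End SubMeasurable.

(** * Random vectors and expected bilinear forms *)

Section RandomVectors.
Context {R : realType} {d : measure_display} {T : measurableType d}.
Variable P : probability T R.

Definition adapted (G : set (set T)) {p : nat} (X : T -> 'cV[R]_p) : Prop :=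
  forall i, sub_measurable G (fun t => X t i ord0) /\
            (fun t => X t i ord0) \in Lfun P 2%:E.

(** Second moments are written as products so that [ex_bil_noise] covers the pairs (w, w), (v, v)
    and (v, w) alike. *)
Definition noise (G : set (set T)) (w v : T -> R) (rho : R) : Prop :=
  [/\ multiplier P G w 0, multiplier P G v 0,
      multiplier P G (fun t => w t * w t) 1,
      multiplier P G (fun t => v t * v t) 1
    & multiplier P G (fun t => w t * v t) rho].

Lemma ex_sum (I : Type) (s : seq I) (F : I -> T -> R) :
  (forall i, F i \in Lfun P 1) ->
  ex P (fun t => \sum_(i <- s) F i t) = \sum_(i <- s) ex P (F i).
Proof.
move=> lF; elim: s => [|i s ih].
  by rewrite big_nil; under eq_fun do rewrite big_nil; exact: ex_cst.
rewrite big_cons; under eq_fun do rewrite big_cons.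
by rewrite exD ?ih//; exact: Lfun1_sum.
Qed.

Lemma meanE (p : nat) (X : T -> 'cV[R]_p) i : mean P X i ord0 = ex P (fun t => X t i ord0).
Proof. by rewrite mxE. Qed.

Section Adapted.
Variable G : set (set T).
Context {p : nat}.
Implicit Types X Y : T -> 'cV[R]_p.

Lemma adapted_Lfun1 X i : adapted G X -> (fun t => X t i ord0) \in Lfun P 1.
Proof. by move=> aX; apply: Lfun2_Lfun1; exact: (aX i).2. Qed.

Lemma adapted_cst (b : 'cV[R]_p) : adapted G (fun=> b).
Proof. by move=> i; split; [exact: sub_measurable_cst | exact: Lfun_cst]. Qed.

Lemma adaptedD X Y : adapted G X -> adapted G Y -> adapted G (fun t => X t + Y t).
Proof.
move=> aX aY i; have [mX lX] := aX i; have [mY lY] := aY i.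
under eq_fun do rewrite mxE.
split; first exact: sub_measurableD.
exact: Lfun2D.
Qed.

Lemma adapted_mulmx (q : nat) (A : 'M[R]_(q, p)) X :
  adapted G X -> adapted G (fun t => A *m X t).
Proof.
move=> aX i; under eq_fun do rewrite mxE.
split.
  apply: sub_measurable_sum => j; apply: sub_measurableM; last exact: (aX j).1.
  exact: sub_measurable_cst.
apply: Lfun2_sum => j; apply: Lfun2Z; exact: (aX j).2.
Qed.

Lemma adaptedN X : adapted G X -> adapted G (fun t => - X t).
Proof.
by move=> /(adapted_mulmx (- 1%:M)); under eq_fun do rewrite mulNmx mul1mx.
Qed.

Lemma adaptedB X Y : adapted G X -> adapted G Y -> adapted G (fun t => X t - Y t).
Proof. by move=> aX aY; apply: adaptedD => //; exact: adaptedN. Qed.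

Lemma mean_cst (b : 'cV[R]_p) : mean P (fun=> b) = b.
Proof. by apply/colP => i; rewrite mxE expectation_cst. Qed.

Lemma meanD X Y : adapted G X -> adapted G Y ->
  mean P (fun t => X t + Y t) = mean P X + mean P Y.
Proof.
move=> aX aY; apply/colP => i; rewrite [RHS]mxE !meanE -exD.
- by congr (ex P _); apply/funext => t; rewrite mxE.
- exact: adapted_Lfun1.
- exact: adapted_Lfun1.
Qed.

Lemma mean_mulmx (q : nat) (A : 'M[R]_(q, p)) X : adapted G X ->
  mean P (fun t => A *m X t) = A *m mean P X.
Proof.
move=> aX; apply/colP => i. rewrite meanE [RHS]mxE.
under eq_fun do rewrite mxE.
rewrite ex_sum; last by move=> j; apply: Lfun1Z; exact: adapted_Lfun1.
by apply: eq_bigr => j _; rewrite exZ ?meanE//; exact: adapted_Lfun1.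
Qed.

Lemma meanN X : adapted G X -> mean P (fun t => - X t) = - mean P X.
Proof.
move=> /(mean_mulmx (- 1%:M)); rewrite mulNmx mul1mx => <-.
by congr (mean P _); apply/funext => t; rewrite mulNmx mul1mx.
Qed.

Lemma meanB X Y : adapted G X -> adapted G Y ->
  mean P (fun t => X t - Y t) = mean P X - mean P Y.
Proof. by move=> aX aY; rewrite meanD ?meanN//; exact: adaptedN. Qed.

Lemma centeredB X Y t : adapted G X -> adapted G Y ->
  X t - Y t - mean P (fun t => X t - Y t) = (X t - mean P X) - (Y t - mean P Y).
Proof.
move=> aX aY; rewrite (meanB aX aY) !opprB [mean P Y - _]addrC addrACA.
by rewrite [- Y t + _]addrC.
Qed.

Lemma mean_centered X : adapted G X -> mean P (fun t => X t - mean P X) = 0.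
Proof.
by move=> aX; rewrite meanB ?mean_cst ?subrr//; exact: adapted_cst.
Qed.

Lemma adapted_centered X : adapted G X -> adapted G (fun t => X t - mean P X).
Proof. by move=> aX; apply: adaptedB => //; exact: adapted_cst. Qed.

End Adapted.

Lemma ae_eq_mean (G : set (set T)) (p : nat) (X Y : T -> 'cV[R]_p) :
    <<s G >> `<=` @measurable d T -> adapted G X -> adapted G Y ->
  {ae P, forall t, X t = Y t} -> mean P X = mean P Y.
Proof.
move=> G_sub aX aY XY; apply/colP => i; rewrite !mxE unlock; congr fine.
apply: ae_eq_integral => //.
- apply/measurable_EFinP; exact: Lfun_measurable (aX i).2.
- apply/measurable_EFinP; exact: Lfun_measurable (aY i).2.
- by apply: filterS XY => t /= -> _.
Qed.

Section ExpectedForms.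
Variable G : set (set T).
Context {p q : nat}.
Implicit Types (M : 'M[R]_(p, q)) (X : T -> 'cV[R]_p) (Y : T -> 'cV[R]_q).

Lemma sub_measurable_bil M X Y : adapted G X -> adapted G Y ->
  sub_measurable G (fun t => bil M (X t) (Y t)).
Proof.
move=> aX aY; under eq_fun do rewrite bil_sum.
do 2 apply: sub_measurable_sum => ?.
apply: sub_measurableM; first exact: sub_measurable_cst.
by apply: sub_measurableM; [exact: (aX _).1 | exact: (aY _).1].
Qed.

Lemma bil_Lfun1 M X Y : adapted G X -> adapted G Y ->
  (fun t => bil M (X t) (Y t)) \in Lfun P 1.
Proof.
move=> aX aY; under eq_fun do rewrite bil_sum.
do 2 apply: Lfun1_sum => ?.
by apply: Lfun1Z; apply: Lfun2M; [exact: (aX _).2 | exact: (aY _).2].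
Qed.

Lemma ex_bil_meanl M X b : adapted G X ->
  ex P (fun t => bil M (X t) b) = bil M (mean P X) b.
Proof.
move=> aX; rewrite bil_sum; under eq_fun do rewrite bil_sum.
have lX i j c : (fun t => M i j * (X t i ord0 * c)) \in Lfun P 1.
  apply: Lfun1Z; under eq_fun do rewrite mulrC.
  by apply: Lfun1Z; exact: adapted_Lfun1 aX.
rewrite ex_sum; last by move=> i; exact: Lfun1_sum.
apply: eq_bigr => i _; rewrite ex_sum//; apply: eq_bigr => j _.
rewrite meanE mulrCA [RHS]mulrC -mulrA -exZ; last exact: adapted_Lfun1 aX.
rewrite -exZ; last by apply: Lfun1Z; exact: adapted_Lfun1 aX.
by congr (ex P _); apply/funext => t; ring.
Qed.

End ExpectedForms.

Lemma ex_bil_meanr (G : set (set T)) (p q : nat) (M : 'M[R]_(p, q)) a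
    (Y : T -> 'cV[R]_q) : adapted G Y ->
  ex P (fun t => bil M a (Y t)) = bil M a (mean P Y).
Proof.
move=> aY; rewrite bil_tr -(ex_bil_meanl _ _ aY).
by congr (ex P _); apply/funext => t; rewrite bil_tr.
Qed.

(** Each cross term pairs a centered vector with a constant and so has expectation zero. This is
    what decouples fluctuations from means. *)
Lemma ex_bil_shift (G : set (set T)) (p q : nat) (M : 'M[R]_(p, q))
    (X : T -> 'cV[R]_p) (Y : T -> 'cV[R]_q) a b :
    adapted G X -> adapted G Y -> mean P X = 0 -> mean P Y = 0 ->
  ex P (fun t => bil M (X t + a) (Y t + b))
  = ex P (fun t => bil M (X t) (Y t)) + bil M a b.
Proof.
move=> aX aY mX mY.
have ca := adapted_cst G a; have cb := adapted_cst G b.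
rewrite (_ : (fun t => _) = (fun t => bil M (X t) (Y t) + bil M (X t) b
    + (bil M a (Y t) + bil M a b))); last first.
  by apply/funext => t; rewrite !(bilDl, bilDr) !addrA.
rewrite exD; last 2 first.
- by apply: Lfun1D; exact: (@bil_Lfun1 G).
- by apply: Lfun1D; exact: (@bil_Lfun1 G).
rewrite !exD; try exact: (@bil_Lfun1 G).
rewrite (ex_bil_meanl _ _ aX) (ex_bil_meanr _ _ aY) mX mY bil0l bil0r ex_cst.
ring.
Qed.

(** The terms linear in one noise have adapted integrable coefficients, hence expectation zero; the
    term with both noises contributes the factor r. *)
Lemma ex_bil_noise (G : set (set T)) (p q : nat) (M : 'M[R]_(p, q))
    (X X' : T -> 'cV[R]_p) (Y Y' : T -> 'cV[R]_q) (w v : T -> R) (r : R) :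
    adapted G X -> adapted G X' -> adapted G Y -> adapted G Y' ->
    multiplier P G w 0 -> multiplier P G v 0 ->
    multiplier P G (fun t => w t * v t) r ->
  ex P (fun t => bil M (X t + w t *: X' t) (Y t + v t *: Y' t))
  = ex P (fun t => bil M (X t) (Y t)) + r * ex P (fun t => bil M (X' t) (Y' t)).
Proof.
move=> aX aX' aY aY' mw mv mwv.
have [l1 e1] := mw _ (sub_measurable_bil M aX' aY) (bil_Lfun1 M aX' aY).
have [l2 e2] := mv _ (sub_measurable_bil M aX aY') (bil_Lfun1 M aX aY').
have [l3 e3] := mwv _ (sub_measurable_bil M aX' aY') (bil_Lfun1 M aX' aY').
rewrite (_ : (fun t => _) = (fun t => bil M (X t) (Y t)
    + (bil M (X' t) (Y t) * w t + (bil M (X t) (Y' t) * v t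
    + bil M (X' t) (Y' t) * (w t * v t))))); last first.
  by apply/funext => t; rewrite !(bilDl, bilDr, bilZl, bilZr); ring.
rewrite exD; [|exact: (@bil_Lfun1 G)|by do 2 apply: Lfun1D => //].
rewrite exD//; last exact: Lfun1D.
by rewrite exD// e1 e2 e3 !mul0r !add0r.
Qed.

(** Square integrability of w Y does not follow from that of w and Y separately: it comes from the
    pull-out property of w^2 applied to the squared entries of Y. *)
Lemma adapted_noise (G G' : set (set T)) (p : nat) (X Y : T -> 'cV[R]_p)
    (w : T -> R) :
    <<s G' >> `<=` @measurable d T -> G `<=` G' -> sub_measurable G' w ->
    multiplier P G (fun t => w t * w t) 1 -> adapted G X -> adapted G Y ->
  adapted G' (fun t => X t + w t *: Y t).
Proof.
move=> G'_sub GG' mw mw2 aX aY; apply: adaptedD => i.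
  by split; [exact: sub_measurable_mono (aX i).1 | exact: (aX i).2].
under eq_fun do rewrite mxE.
have [mY lY] := aY i; have mY' := sub_measurable_mono GG' mY.
have mwY : sub_measurable G' (fun t => w t * Y t i ord0).
  exact: sub_measurableM.
split=> //; apply/Lfun2P; split; first exact: sub_measurable_measurable mwY.
have lY2 := Lfun2M lY lY.
have [l _] := mw2 _ (sub_measurableM mY mY) lY2.
rewrite (_ : (fun t => _) = (fun t => Y t i ord0 * Y t i ord0 * (w t * w t)))//.
by apply/funext => t; ring.
Qed.

Lemma mean_noise (G : set (set T)) (p : nat) (X Y : T -> 'cV[R]_p) (w : T -> R) :
    multiplier P G w 0 -> adapted G X -> adapted G Y ->
  mean P (fun t => X t + w t *: Y t) = mean P X.
Proof.
move=> mw aX aY; apply/colP => i; rewrite !meanE.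
have [lw ew] := mw _ (aY i).1 (adapted_Lfun1 i aY).
rewrite (_ : (fun t => _) = (fun t => X t i ord0 + Y t i ord0 * w t)).
  by rewrite exD// ?ew ?mul0r ?addr0//; exact: adapted_Lfun1 aX.
by apply/funext => t; rewrite !mxE mulrC.
Qed.

Section ExpectedJointForms.
Variable G : set (set T).
Context {n : nat}.
Implicit Types (Px Pxy Py : 'M[R]_n) (X Y : T -> 'cV[R]_n).

Lemma joint_form_Lfun1 r Px Pxy Py X Y : adapted G X -> adapted G Y ->
  (fun t => joint_form r Px Pxy Py (X t) (Y t)) \in Lfun P 1.
Proof.
move=> aX aY; apply: Lfun1D; last exact: (@bil_Lfun1 G).
apply: Lfun1D; first exact: (@bil_Lfun1 G).
by apply: Lfun1Z; exact: (@bil_Lfun1 G).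
Qed.

Lemma ex_joint_form r Px Pxy Py X Y : adapted G X -> adapted G Y ->
  ex P (fun t => joint_form r Px Pxy Py (X t) (Y t))
  = ex P (fun t => bil Px (X t) (X t)) + 2 * r * ex P (fun t => bil Pxy (Y t) (X t))
    + ex P (fun t => bil Py (Y t) (Y t)).
Proof.
move=> aX aY; have lyx := @bil_Lfun1 G _ _ Pxy _ _ aY aX.
have lx := @bil_Lfun1 G _ _ Px _ _ aX aX.
by rewrite exD ?exD ?exZ//; [exact: Lfun1Z | apply: Lfun1D => //; exact: Lfun1Z
  | exact: (@bil_Lfun1 G)].
Qed.

Lemma ex_joint_form_shift r Px Pxy Py X Y a b :
    adapted G X -> adapted G Y -> mean P X = 0 -> mean P Y = 0 ->
  ex P (fun t => joint_form r Px Pxy Py (X t + a) (Y t + b))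
  = ex P (fun t => joint_form r Px Pxy Py (X t) (Y t)) + joint_form r Px Pxy Py a b.
Proof.
move=> aX aY mX mY.
have ca := adapted_cst G a; have cb := adapted_cst G b.
rewrite !ex_joint_form//; try exact: adaptedD.
by rewrite !(@ex_bil_shift G)// /joint_form !quadE; ring.
Qed.

End ExpectedJointForms.

Lemma ex_joint_form_noise (G G' : set (set T)) (n : nat) (Px Pxy Py : 'M[R]_n)
    (X X' Y Y' : T -> 'cV[R]_n) (w v : T -> R) (rho : R) :
    noise G w v rho ->
    adapted G X -> adapted G X' -> adapted G Y -> adapted G Y' ->
    adapted G' (fun t => X t + w t *: X' t) ->
    adapted G' (fun t => Y t + v t *: Y' t) ->
  ex P (fun t => joint_form 1 Px Pxy Py (X t + w t *: X' t) (Y t + v t *: Y' t))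
  = ex P (fun t => joint_form 1 Px Pxy Py (X t) (Y t))
    + ex P (fun t => joint_form rho Px Pxy Py (X' t) (Y' t)).
Proof.
move=> [mw mv mww mvv mwv] aX aX' aY aY' aXn aYn.
have mvw : multiplier P G (fun t => v t * w t) rho.
  by move: mwv; congr multiplier; apply/funext => t; rewrite mulrC.
rewrite (ex_joint_form _ _ _ _ aXn aYn) (ex_joint_form _ _ _ _ aX aY).
rewrite (ex_joint_form _ _ _ _ aX' aY').
by rewrite !(@ex_bil_noise G _ _ _ _ _ _ _ _ _ _ aX aX' aX aX' mw mw mww,
   @ex_bil_noise G _ _ _ _ _ _ _ _ _ _ aY aY' aX aX' mv mw mvw,
   @ex_bil_noise G _ _ _ _ _ _ _ _ _ _ aY aY' aY aY' mv mv mvv); ring.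
Qed.

End RandomVectors.

(** * The dynamic programming recursion *)

Section RiccatiDefiniteness.
Context {R : realType} {n m : nat}.
Variables (N : nat) (K : coefficients R n m) (rho : R) (M : riccati_matrices R n).
Hypothesis Q_psd : forall k, (k <= N)%N -> psd (cQ K k) /\ psd (cQ K k + cQb K k).
Hypothesis R_pd : forall k, (k < N)%N -> pd (cR K k) /\ pd (cR K k + cRb K k).
Hypothesis M_riccati : riccati_system K rho M N.

Lemma W1_pd k : (k < N)%N -> psd (Px M k.+1) -> pd (W1 K M k).
Proof. by move=> /R_pd[pR _] pP; exact: pd_complete_square. Qed.

Lemma W2_pd k : (k < N)%N -> psd (Px M k.+1) ->
  psd (Px M k.+1 + Pxb M k.+1) -> pd (W2 K M k).
Proof. by move=> /R_pd[_ pR] pP pPb; exact: pd_complete_square. Qed.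

Lemma riccati_psd k : (k <= N)%N -> psd (Px M k) /\ psd (Px M k + Pxb M k).
Proof.
have [[[xN xbN] _ _] step] := M_riccati.
(* Backward induction in k, run as induction on the distance j = N - k to the horizon. *)
move=> kN; rewrite -(subKn kN); elim: (N - k)%N (leq_subr k N) => [|j ih] jN.
  by rewrite subn0 xN xbN; exact: Q_psd.
have [p1 p2] := ih (ltnW jN).
have kN' : (N - j.+1 < N)%N by rewrite ltn_subrL /=; exact: leq_trans jN.
have [[-> ->] _ _] := step _ kN'.
have e : (N - j.+1).+1 = (N - j)%N by rewrite subnSK.
have [q1 q2] := Q_psd (ltnW kN'); have [r1 r2] := R_pd kN'.
rewrite -e in p1 p2.
by split; exact: psd_complete_square.
Qed.

End RiccatiDefiniteness.

Ltac adapted_tac := lazymatch goal with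
  | |- adapted _ _ (fun _ => ?b) => exact: adapted_cst
  | |- adapted _ _ (fun t => @?f t - @?g t) =>
      apply: (adaptedB (X := f) (Y := g)); adapted_tac
  | |- adapted _ _ (fun t => @?f t + @?g t) =>
      apply: (adaptedD (X := f) (Y := g)); adapted_tac
  | |- adapted _ _ (fun t => ?A *m @?f t) =>
      apply: (adapted_mulmx A (X := f)); adapted_tac
  | _ => assumption
  end.

(** * One Bellman step for arbitrary adapted states and control *)

Section BellmanStep.
Context {R : realType} {d : measure_display} {T : measurableType d}.
Context {n m : nat}.
Variables (P : probability T R) (K : coefficients R n m) (rho : R).
Variables (M : riccati_matrices R n) (k : nat).

(** The successor clause of [state_x] for an arbitrary current state and control, and convertible to
    it along a trajectory. *)
Definition next_x (x : T -> 'cV[R]_n) (u : T -> 'cV[R]_m) (w : T -> R) (t : T) :=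
  (mA K k *m x t + mAb K k *m mean P x + mB K k *m u t + mBb K k *m mean P u)
  + w t *: (mC K k *m x t + mCb K k *m mean P x + mD K k *m u t
            + mDb K k *m mean P u).

Definition next_y (y : T -> 'cV[R]_n) (v : T -> R) (t : T) :=
  (mF K k *m y t + mFb K k *m mean P y)
  + v t *: (mG K k *m y t + mGb K k *m mean P y).

(** The candidate cost-to-go from time j: fluctuations are weighted by P_j, means by P_j +
    Pbar_j. *)
Definition value (j : nat) (x y : T -> 'cV[R]_n) : R :=
  ex P (fun t => joint_form 1 (Px M j) (Pxy M j) (Py M j)
                   (x t - mean P x) (y t - mean P y))
  + joint_form 1 (Px M j + Pxb M j) (Pxy M j + Pxyb M j) (Py M j + Pyb M j)
      (mean P x) (mean P y).

Definition stage_cost (x y : T -> 'cV[R]_n) (u : T -> 'cV[R]_m) : R :=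
  ex P (fun t => quad (cQ K k) (x t - y t) + quad (cR K k) (u t))
  + quad (cQb K k) (mean P x - mean P y) + quad (cRb K k) (mean P u).

(** Up to sign, [gain1] is the fluctuation and [gain2] the mean of the optimal control. *)
Definition gain1 (a b : 'cV[R]_n) : 'cV[R]_m :=
  invmx (W1 K M k) *m ((H1 K M k)^T *m a + (H3 K rho M k)^T *m b).

Definition gain2 (a b : 'cV[R]_n) : 'cV[R]_m :=
  invmx (W2 K M k) *m ((H2 K M k)^T *m a + (H4 K rho M k)^T *m b).

Definition gap (x y : T -> 'cV[R]_n) (u : T -> 'cV[R]_m) : R :=
  ex P (fun t => quad (W1 K M k)
    ((u t - mean P u) + gain1 (x t - mean P x) (y t - mean P y)))
  + quad (W2 K M k) (mean P u + gain2 (mean P x) (mean P y)).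

Variables (G G' : set (set T)) (w v : T -> R).
Variables (x y : T -> 'cV[R]_n) (u : T -> 'cV[R]_m).
Hypothesis G'_sub : <<s G' >> `<=` @measurable d T.
Hypotheses (GG' : G `<=` G') (mw : sub_measurable G' w) (mv : sub_measurable G' v).
Hypothesis wv_noise : noise P G w v rho.
Hypotheses (ax : adapted P G x) (ay : adapted P G y) (au : adapted P G u).

Lemma adapted_next_x : adapted P G' (next_x x u w).
Proof.
have [_ _ mww _ _] := wv_noise.
by apply: (adapted_noise G'_sub GG' mw mww); adapted_tac.
Qed.

Lemma adapted_next_y : adapted P G' (next_y y v).
Proof.
have [_ _ _ mvv _] := wv_noise.
by apply: (adapted_noise G'_sub GG' mv mvv); adapted_tac.
Qed.

Let X t := x t - mean P x.
Let Y t := y t - mean P y.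
Let U t := u t - mean P u.

Let aX : adapted P G X. Proof. exact: adapted_centered. Qed.
Let aY : adapted P G Y. Proof. exact: adapted_centered. Qed.
Let aU : adapted P G U. Proof. exact: adapted_centered. Qed.
Let mX : mean P X = 0. Proof. exact: mean_centered ax. Qed.
Let mY : mean P Y = 0. Proof. exact: mean_centered ay. Qed.
Let mU : mean P U = 0. Proof. exact: mean_centered au. Qed.

Lemma mean_next_x : mean P (next_x x u w)
  = (mA K k + mAb K k) *m mean P x + (mB K k + mBb K k) *m mean P u.
Proof.
have [mw0 _ _ _ _] := wv_noise.
rewrite (mean_noise mw0); try by adapted_tac.
rewrite !(meanD (G := G)); try by adapted_tac.
rewrite !mean_cst (mean_mulmx _ ax) (mean_mulmx _ au) !mulmxDl.
by rewrite !addrA.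
Qed.

Lemma mean_next_y : mean P (next_y y v) = (mF K k + mFb K k) *m mean P y.
Proof.
have [_ mv0 _ _ _] := wv_noise.
rewrite (mean_noise mv0); try by adapted_tac.
rewrite (meanD (G := G)); try by adapted_tac.
by rewrite mean_cst (mean_mulmx _ ay) mulmxDl.
Qed.

(** [cx] and [cy] are the mean diffusions. They survive centering of the next state because they are
    multiplied by the noise. *)
Let cx := (mC K k + mCb K k) *m mean P x + (mD K k + mDb K k) *m mean P u.
Let cy := (mG K k + mGb K k) *m mean P y.

Lemma next_x_centered t : next_x x u w t - mean P (next_x x u w)
  = (mA K k *m X t + mB K k *m U t) + w t *: (mC K k *m X t + mD K k *m U t + cx).
Proof.
rewrite mean_next_x /next_x /X /U /cx !mulmxDl !mulmxBr.
by apply/colP => i; do ![rewrite mxE | rewrite mxE]; ring.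
Qed.

Lemma next_y_centered t : next_y y v t - mean P (next_y y v)
  = mF K k *m Y t + v t *: (mG K k *m Y t + cy).
Proof.
rewrite mean_next_y /next_y /Y /cy !mulmxDl !mulmxBr.
by apply/colP => i; rewrite !mxE; ring.
Qed.

Let aD : adapted P G (fun t => mA K k *m X t + mB K k *m U t).
Proof. by adapted_tac. Qed.
Let aS : adapted P G (fun t => mC K k *m X t + mD K k *m U t).
Proof. by adapted_tac. Qed.
Let aF : adapted P G (fun t => mF K k *m Y t).
Proof. by adapted_tac. Qed.
Let aG : adapted P G (fun t => mG K k *m Y t).
Proof. by adapted_tac. Qed.

(** The noise moments separate drift from diffusion; the zero mean of the fluctuating diffusion then
    separates it from [cx] and [cy]. The last summand depends on means only. *)
Lemma ex_joint_form_next (Q1 Q2 Q3 : 'M[R]_n) :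
  ex P (fun t => joint_form 1 Q1 Q2 Q3
    (next_x x u w t - mean P (next_x x u w))
    (next_y y v t - mean P (next_y y v)))
  = ex P (fun t => joint_form 1 Q1 Q2 Q3
      (mA K k *m X t + mB K k *m U t) (mF K k *m Y t))
    + ex P (fun t => joint_form rho Q1 Q2 Q3
      (mC K k *m X t + mD K k *m U t) (mG K k *m Y t))
    + joint_form rho Q1 Q2 Q3 cx cy.
Proof.
have acx : adapted P G (fun t => mC K k *m X t + mD K k *m U t + cx).
  by adapted_tac.
have acy : adapted P G (fun t => mG K k *m Y t + cy) by adapted_tac.
have nx := adapted_centered adapted_next_x.
have ny := adapted_centered adapted_next_y.
under eq_fun do rewrite next_x_centered next_y_centered.
rewrite (ex_joint_form_noise (G' := G') _ _ _ wv_noise)//; last 2 first.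
- by move: nx; under eq_fun do rewrite next_x_centered.
- by move: ny; under eq_fun do rewrite next_y_centered.
have mS : mean P (fun t => mC K k *m X t + mD K k *m U t) = 0.
  rewrite (meanD (G := G)); try by adapted_tac.
  by rewrite (mean_mulmx _ aX) (mean_mulmx _ aU) mX mU !mulmx0 addr0.
have mG : mean P (fun t => mG K k *m Y t) = 0.
  by rewrite (mean_mulmx _ aY) mY mulmx0.
rewrite -addrA; congr (_ + _).
exact: (ex_joint_form_shift rho Q1 Q2 Q3 cx cy aS aG mS mG).
Qed.

Lemma ex_quad_split {p : nat} (Q : 'M[R]_p) (Z : T -> 'cV[R]_p) :
  adapted P G Z ->
  ex P (fun t => quad Q (Z t))
  = ex P (fun t => quad Q (Z t - mean P Z)) + quad Q (mean P Z).
Proof.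
move=> aZ; have aZc := adapted_centered aZ.
rewrite !quadE -(ex_bil_shift _ _ _ aZc aZc); try exact: mean_centered aZ.
by congr (ex P _); apply/funext => t; rewrite !subrK.
Qed.

(** The square is completed twice: for the fluctuations at each sample point, followed by
    integration, and once for the deterministic means. *)
Lemma bellman_step :
    riccati_step_x K M k -> riccati_step_xy K rho M k ->
    riccati_step_y K rho M k ->
    psd (cQ K k) -> psd (cQ K k + cQb K k) -> pd (cR K k) ->
    pd (cR K k + cRb K k) -> psd (Px M k.+1) -> psd (Px M k.+1 + Pxb M k.+1) ->
  stage_cost x y u + value k.+1 (next_x x u w) (next_y y v)
  = value k x y + gap x y u.
Proof.
move=> [Ex Exb] [Exy Exyb] [Ey Eyb] pQ pQb pR pRb pP pPb.
have [/symmetricmxP sQ _] := pQ; have [/symmetricmxP sQb _] := pQb.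
have [/symmetricmxP sR _] := pR; have [/symmetricmxP sRb _] := pRb.
have [/symmetricmxP sP _] := pP; have [/symmetricmxP sPb _] := pPb.
have W1u := pd_unitmx (pd_complete_square (mB K k) (mD K k) pR pP pP).
have W2u := pd_unitmx (pd_complete_square (mB K k + mBb K k)
  (mD K k + mDb K k) pRb pPb pP).
have fluct t : quad (cQ K k) (X t - Y t) + quad (cR K k) (U t)
    + joint_form 1 (Px M k.+1) (Pxy M k.+1) (Py M k.+1)
        (mA K k *m X t + mB K k *m U t) (mF K k *m Y t)
    + joint_form rho (Px M k.+1) (Pxy M k.+1) (Py M k.+1)
        (mC K k *m X t + mD K k *m U t) (mG K k *m Y t)
    = quad (W1 K M k) (U t + gain1 (X t) (Y t))
      + joint_form 1 (Px M k) (Pxy M k) (Py M k) (X t) (Y t).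
  rewrite Ex Exy Ey /gain1 /W1 /H1 /H3.
  exact: (complete_square rho (mA K k) (mC K k) (mF K k) (mG K k)
    (Pxy M k.+1) (Py M k.+1) (Pxy M k.+1) (Py M k.+1) sQ sR sP sP W1u).
(* The drift of the means carries the weight P + Pbar, but their diffusion, inherited from the next
   fluctuation, carries P alone. *)
have means : quad (cQ K k + cQb K k) (mean P x - mean P y)
    + quad (cR K k + cRb K k) (mean P u)
    + joint_form 1 (Px M k.+1 + Pxb M k.+1) (Pxy M k.+1 + Pxyb M k.+1)
        (Py M k.+1 + Pyb M k.+1)
        (mean P (next_x x u w)) (mean P (next_y y v))
    + joint_form rho (Px M k.+1) (Pxy M k.+1) (Py M k.+1) cx cy
    = quad (W2 K M k) (mean P u + gain2 (mean P x) (mean P y))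
      + joint_form 1 (Px M k + Pxb M k) (Pxy M k + Pxyb M k) (Py M k + Pyb M k)
          (mean P x) (mean P y).
  rewrite mean_next_x mean_next_y Exb Exyb Eyb /gain2 /W2 /H2 /H4 -opprD.
  exact: (complete_square rho (mA K k + mAb K k) (mC K k + mCb K k)
    (mF K k + mFb K k) (mG K k + mGb K k) (Pxy M k.+1 + Pxyb M k.+1)
    (Py M k.+1 + Pyb M k.+1) (Pxy M k.+1) (Py M k.+1) sQb sRb sPb sP W2u).
have agap : adapted P G (fun t => U t + gain1 (X t) (Y t)).
  by rewrite /gain1; adapted_tac.
have axy : adapted P G (fun t => x t - y t) by adapted_tac.
have aXY : adapted P G (fun t => X t - Y t) by adapted_tac.
have lgap := bil_Lfun1 (W1 K M k) agap agap.
have lQ := bil_Lfun1 (cQ K k) axy axy.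
have lR := bil_Lfun1 (cR K k) au au.
have lQc := bil_Lfun1 (cQ K k) aXY aXY.
have lRc := bil_Lfun1 (cR K k) aU aU.
have lP := joint_form_Lfun1 1 (Px M k) (Pxy M k) (Py M k) aX aY.
have lP1 := joint_form_Lfun1 1 (Px M k.+1) (Pxy M k.+1) (Py M k.+1) aD aF.
have lP2 := joint_form_Lfun1 rho (Px M k.+1) (Pxy M k.+1) (Py M k.+1) aS aG.
have := congr1 (ex P) (funext fluct).
rewrite (exD (Lfun1D (Lfun1D lQc lRc) lP1) lP2) (exD (Lfun1D lQc lRc) lP1).
rewrite (exD lQc lRc) (exD lgap lP) => {}fluct.
rewrite /stage_cost (exD lQ lR) (ex_quad_split _ axy) (ex_quad_split _ au).
rewrite (_ : (fun t => quad (cQ K k) (_ - _ - _))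
    = (fun t => quad (cQ K k) (X t - Y t))); last first.
  by apply/funext => t; rewrite (centeredB _ ax ay).
rewrite (meanB ax ay) /value ex_joint_form_next /gap.
(* Splitting the expected stage cost leaves Q_k and R_k on the means, and the bar weights are added
   to these; expanding the sums makes all the relations linear in common atoms. *)
move: means; rewrite ![quad (_ + _) _]bilD -!quadE.
move: fluct; rewrite /X /Y /U => fluct means.
by lra.
Qed.


End BellmanStep.

(** * The control with zero gap at one stage *)

Section OptimalControl.
Context {R : realType} {d : measure_display} {T : measurableType d}.
Context {n m : nat}.
Variables (P : probability T R) (K : coefficients R n m) (rho : R).
Variables (M : riccati_matrices R n) (k : nat) (G : set (set T)).
Variables x y : T -> 'cV[R]_n.
Hypotheses (W1_pos : pd (W1 K M k)) (W2_pos : pd (W2 K M k)).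
Hypotheses (ax : adapted P G x) (ay : adapted P G y).

Definition optimal_control (t : T) : 'cV[R]_m :=
  - (invmx (W1 K M k) *m (H1 K M k)^T *m (x t - mean P x))
  - invmx (W2 K M k) *m (H2 K M k)^T *m mean P x
  - invmx (W1 K M k) *m (H3 K rho M k)^T *m (y t - mean P y)
  - invmx (W2 K M k) *m (H4 K rho M k)^T *m mean P y.

Lemma optimal_controlE t : optimal_control t
  = - gain1 K rho M k (x t - mean P x) (y t - mean P y)
    - gain2 K rho M k (mean P x) (mean P y).
Proof.
rewrite /optimal_control /gain1 /gain2 !mulmxDr !mulmxA !opprD.
by rewrite [RHS]addrA; congr (_ + _); exact: addrAC.
Qed.

Lemma gap_ge0 u : 0 <= gap P K rho M k x y u.
Proof.
by rewrite addr_ge0 ?pd_quad_ge0// ex_ge0// => t; exact: pd_quad_ge0.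
Qed.

Lemma mean_optimal_control :
  mean P optimal_control = - gain2 K rho M k (mean P x) (mean P y).
Proof.
have aX := adapted_centered ax; have aY := adapted_centered ay.
have ag : adapted P G
    (fun t => gain1 K rho M k (x t - mean P x) (y t - mean P y)).
  by rewrite /gain1; adapted_tac.
rewrite (funext optimal_controlE).
rewrite (meanB (adaptedN ag) (adapted_cst P G _)) mean_cst.
rewrite (meanN ag) /gain1 (mean_mulmx (G := G)); last by adapted_tac.
rewrite (meanD (G := G)); try by adapted_tac.
rewrite (mean_mulmx _ aX) (mean_mulmx _ aY) (mean_centered ax) (mean_centered ay).
by rewrite !mulmx0 addr0 mulmx0 oppr0 add0r.
Qed.

Lemma gap_optimal_control : gap P K rho M k x y optimal_control = 0.
Proof.
rewrite /gap mean_optimal_control addNr quadE bil0l addr0.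
under eq_fun do rewrite optimal_controlE opprK subrK addNr quadE bil0l.
exact: ex_cst.
Qed.

(** Both summands are nonnegative, hence zero. The second fixes the mean of u; the first then fixes
    u almost surely, since a nonnegative integrand with zero expectation vanishes almost
    everywhere. *)
Lemma gap_eq0 u : adapted P G u -> gap P K rho M k x y u = 0 ->
  {ae P, forall t, u t = optimal_control t}.
Proof.
move=> au /eqP; rewrite paddr_eq0; last 2 first.
- by apply: ex_ge0 => t; exact: pd_quad_ge0.
- exact: pd_quad_ge0.
move=> /andP[/eqP ex0 /eqP /(pd_quad_eq0 W2_pos)/eqP].
rewrite addr_eq0 => /eqP mu.
have aX := adapted_centered ax; have aY := adapted_centered ay.
have aU := adapted_centered au.
have ag : adapted P G (fun t => (u t - mean P u)
    + gain1 K rho M k (x t - mean P x) (y t - mean P y)).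
  by rewrite /gain1; adapted_tac.
have := ex_ge0_eq0 (bil_Lfun1 _ ag ag) _ ex0.
move=> /(_ (fun t => pd_quad_ge0 _ W1_pos)).
apply: filterS => t /(pd_quad_eq0 W1_pos)/eqP.
rewrite addr_eq0 subr_eq mu => /eqP ->.
by rewrite optimal_controlE.
Qed.

End OptimalControl.

(** * Trajectories under linear feedback *)

Section Filtration.
Context {R : realType} {d : measure_display} {T : measurableType d}.
Context {n : nat}.
Variables (P : probability T R) (zx zy : T -> 'cV[R]_n) (w v : nat -> T -> R).
Hypotheses (mw : forall k, measurable_fun setT (w k))
           (mv : forall k, measurable_fun setT (v k)).
Hypotheses (zx_L2 : square_integrable P zx) (zy_L2 : square_integrable P zy).

(* [filtration zx zy w v k] unfolds to [<<s generators k >>]. *)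
Definition generators (k : nat) : set (set T) :=
  (\bigcup_(i in [set: 'I_n])
     (preimage_set_system setT (fun t => zx t i ord0) measurable `|`
      preimage_set_system setT (fun t => zy t i ord0) measurable)) `|`
  (\bigcup_(l in [set l | (l < k)%N])
     (preimage_set_system setT (w l) measurable `|`
      preimage_set_system setT (v l) measurable)).

Lemma generators_measurable k : <<s generators k >> `<=` @measurable d T.
Proof.
have pre (f : T -> R) : measurable_fun setT f ->
    preimage_set_system setT f measurable `<=` @measurable d T.
  by move=> mf _ [B mB <-]; exact: mf.
apply: smallest_sub; first exact: sigma_algebra_measurable.
move=> A [[i _]|[l _]] []; apply: pre => //.
- exact: Lfun_measurable (zx_L2 i).
- exact: Lfun_measurable (zy_L2 i).
Qed.

Lemma generatorsS k : generators k `<=` generators k.+1.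
Proof.
move=> A [?|[l lk ?]]; [by left | right; exists l => //=].
exact: ltnW.
Qed.

Lemma sub_measurable_w k : sub_measurable (generators k.+1) (w k).
Proof.
by apply: sub_measurable_generator => A ?; right; exists k => //=; left.
Qed.

Lemma sub_measurable_v k : sub_measurable (generators k.+1) (v k).
Proof.
by apply: sub_measurable_generator => A ?; right; exists k => //=; right.
Qed.

Lemma adapted_zx : adapted P (generators 0) zx.
Proof.
move=> i; split; last exact: zx_L2.
by apply: sub_measurable_generator => A ?; left; exists i => //; left.
Qed.

Lemma adapted_zy : adapted P (generators 0) zy.
Proof.
move=> i; split; last exact: zy_L2.
by apply: sub_measurable_generator => A ?; left; exists i => //; right.
Qed.

Lemma noise_model_noise (N : nat) (rho : R) k :
  noise_model P N rho zx zy w v -> (k < N)%N ->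
  noise P (generators k) (w k) (v k) rho.
Proof.
move=> nm kN; have Gs := generators_measurable (k := k).
have cm X c : is_cond_expectation P (filtration zx zy w v k) X (cst c) ->
    cond_moment P (generators k) X c.
  by move=> ce; exact: cond_expectation_moment.
have [/cm w1 /cm v1 /cm w2 /cm v2 /cm wv] := nm k kN.
have sq (f : T -> R) : (fun t => f t * f t) = (fun t => f t ^+ 2).
  by apply/funext => t; rewrite expr2.
split.
- exact: (noise_multiplier Gs).
- exact: (noise_multiplier Gs).
- by rewrite sq; apply: (ge0_multiplier Gs) => // t; exact: sqr_ge0.
- by rewrite sq; apply: (ge0_multiplier Gs) => // t; exact: sqr_ge0.
- exact: (noise_product_multiplier Gs).
Qed.

End Filtration.

(** * Cost, optimality and uniqueness along trajectories *)

Section Trajectories.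
Context {R : realType} {d : measure_display} {T : measurableType d}.
Context {n m : nat}.
Variables (P : probability T R) (K : coefficients R n m) (rho : R) (N : nat).
Variables (w v : nat -> T -> R) (zx zy : T -> 'cV[R]_n).
Hypotheses (mw : forall k, measurable_fun setT (w k))
           (mv : forall k, measurable_fun setT (v k)).
Hypotheses (zx_L2 : square_integrable P zx) (zy_L2 : square_integrable P zy).
Hypothesis nm : noise_model P N rho zx zy w v.

Notation sx := (state_x P K w zx).
Notation sy := (state_y P K v zy).
Notation G := (generators zx zy w v).

Let G_sub := generators_measurable mw mv zx_L2 zy_L2.

Let mwG k : sub_measurable (G k.+1) (w k).
Proof. exact: sub_measurable_w. Qed.
Let mvG k : sub_measurable (G k.+1) (v k).
Proof. exact: sub_measurable_v. Qed.
Let GS k : G k `<=` G k.+1.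
Proof. exact: generatorsS. Qed.
Let wv_noise k (kN : (k < N)%N) := noise_model_noise mw mv zx_L2 zy_L2 nm kN.

Lemma adapted_state_y k : (k <= N)%N -> adapted P (G k) (sy k).
Proof.
elim: k => [_|k ih kN]; first exact: adapted_zy.
exact: (adapted_next_y K k (G_sub (k := k.+1)) (GS (k := k))
  (mvG (k := k)) (wv_noise kN)
  (ih (ltnW kN))).
Qed.

(** The premise on the state lets this serve inside the induction that proves [adapted_state_x]. *)
Lemma linear_feedback_adapted u k : linear_feedback P K w v zx zy N u ->
  (k < N)%N -> adapted P (G k) (sx u k) -> adapted P (G k) (u k).
Proof.
move=> [Lx [Lxb [Ly [Lyb uE]]]] kN ax.
have ay := adapted_state_y (ltnW kN).
rewrite (_ : u k = (fun t => Lx k *m sx u k t + Lxb k *m mean P (sx u k)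
  + Ly k *m sy k t + Lyb k *m mean P (sy k))); last exact/funext/uE.
by adapted_tac.
Qed.

Lemma adapted_state_x u k : linear_feedback P K w v zx zy N u ->
  (k <= N)%N -> adapted P (G k) (sx u k).
Proof.
move=> fu; elim: k => [_|k ih kN]; first exact: adapted_zx.
have ax := ih (ltnW kN).
exact: (adapted_next_x K k (G_sub (k := k.+1)) (GS (k := k))
  (mwG (k := k)) (wv_noise kN)
  ax (linear_feedback_adapted fu kN ax)).
Qed.

(** The feedback law is circular, as the state depends on the control. The recursion is therefore on
    the closed-loop state alone, and the control is read off from it. *)
Lemma feedback_exists (Lx Lxb Ly Lyb : nat -> 'M[R]_(m, n)) :
  exists u, forall k t,
    u k t = Lx k *m sx u k t + Lxb k *m mean P (sx u k)
          + Ly k *m sy k t + Lyb k *m mean P (sy k).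
Proof.
pose fb k (x : T -> 'cV[R]_n) t := Lx k *m x t + Lxb k *m mean P x
  + Ly k *m sy k t + Lyb k *m mean P (sy k).
pose closed_loop := fix closed_loop k := match k with
  | 0 => zx
  | j.+1 => next_x P K j (closed_loop j) (fb j (closed_loop j)) (w j)
  end.
exists (fun k => fb k (closed_loop k)).
suff E k : sx (fun k => fb k (closed_loop k)) k = closed_loop k.
  by move=> k t; rewrite E.
by elim: k => [//|k ih] /=; rewrite ih.
Qed.

Variable M : riccati_matrices R n.
Hypothesis Q_psd : forall k, (k <= N)%N -> psd (cQ K k) /\ psd (cQ K k + cQb K k).
Hypothesis R_pd : forall k, (k < N)%N -> pd (cR K k) /\ pd (cR K k + cRb K k).
Hypothesis M_riccati : riccati_system K rho M N.

Let P_psd k (kN : (k <= N)%N) := riccati_psd Q_psd R_pd M_riccati kN.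

Lemma W1_pdN k : (k < N)%N -> pd (W1 K M k).
Proof. by move=> kN; apply: (W1_pd R_pd kN); exact: (P_psd kN).1. Qed.

Lemma W2_pdN k : (k < N)%N -> pd (W2 K M k).
Proof. by move=> kN; have [p1 p2] := P_psd kN; exact: (W2_pd R_pd kN). Qed.

Notation stage u k := (stage_cost P K k (sx u k) (sy k) (u k)).
Notation val k x := (value P M k x (sy k)).
Notation gapk u k := (gap P K rho M k (sx u k) (sy k) (u k)).

(** Summing the Bellman identity telescopes the values. Adapted square-integrable trajectories make
    every expectation finite, so the cost is a real number. *)
Lemma cost_gap u : linear_feedback P K w v zx zy N u ->
  cost P K w v zx zy N u = (value P M 0 zx zy + \sum_(k < N) gapk u k)%:E.
Proof.
move=> fu.
have stepE k : (k < N)%N -> stage u k + val k.+1 (sx u k.+1)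
    = val k (sx u k) + gapk u k.
  move=> kN; have ax := adapted_state_x fu (ltnW kN).
  have [_ /(_ _ kN)[Sx Sxy Sy]] := M_riccati.
  have [p1 p2] := P_psd kN.
  have [q1 q2] := Q_psd (ltnW kN); have [r1 r2] := R_pd kN.
  exact: (bellman_step (G_sub (k := k.+1)) (GS (k := k))
    (mwG (k := k)) (mvG (k := k))
    (wv_noise kN) ax
    (adapted_state_y (ltnW kN)) (linear_feedback_adapted fu kN ax)).
have telescope j : (j <= N)%N -> \sum_(k < j) stage u k + val j (sx u j)
    = value P M 0 zx zy + \sum_(k < j) gapk u k.
  elim: j => [_|j ih jN]; first by rewrite !big_ord0 addr0 add0r.
  rewrite !big_ord_recr; move: (ih (ltnW jN)) (stepE _ jN) => /= ihE stE.
  by rewrite -addrA stE addrA ihE [RHS]addrA.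
have axN := adapted_state_x fu (leqnn N).
have ayN := adapted_state_y (leqnn N).
(* The terminal data Q_N, -Q_N, Q_N turn the joint form into the form Q_N of x - y, which identifies
   the terminal cost with the value at N. *)
have terminal : ('E_P[fun t => quad (cQ K N) (tracking_error P K w v zx zy u N t)]
    + (quad (cQb K N) (mean P (tracking_error P K w v zx zy u N)))%:E)%E
    = (val N (sx u N))%:E.
  have aeN := adaptedB axN ayN.
  rewrite ex_EFin; last exact: (bil_Lfun1 _ aeN aeN).
  rewrite -EFinD; congr (_%:E).
  have [[[EPx EPxb] [EPxy EPxyb] [EPy EPyb]] _] := M_riccati.
  have [/symmetricmxP sQ _] := (Q_psd (leqnn N)).1.
  have [/symmetricmxP sQb _] := (Q_psd (leqnn N)).2.
  rewrite /value EPx EPxb EPxy EPxyb EPy EPyb -opprD !joint_form_diff//.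
  under [in RHS]eq_fun do rewrite joint_form_diff//.
  rewrite (ex_quad_split _ aeN) (meanB axN ayN) [quad (_ + _) _]bilD addrA.
  congr (_ + _ + _); congr (ex P _); apply/funext => t.
  by rewrite -(centeredB _ axN ayN) (meanB axN ayN).
have stages k : (k < N)%N ->
  ('E_P[fun t => (quad (cQ K k) (tracking_error P K w v zx zy u k t)
          + quad (cR K k) (u k t)
          + quad (cQb K k) (mean P (tracking_error P K w v zx zy u k))
          + quad (cRb K k) (mean P (u k)))%R])%E = (stage u k)%:E.
  move=> kN; have ax := adapted_state_x fu (ltnW kN).
  have ay := adapted_state_y (ltnW kN).
  have au := linear_feedback_adapted fu kN ax.
  have axy := adaptedB ax ay.
  have l1 := bil_Lfun1 (cQ K k) axy axy; have l2 := bil_Lfun1 (cR K k) au au.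
  have l12 := Lfun1D l1 l2.
  have lc c : (fun=> c : R) \in Lfun P 1 by exact: Lfun_cst.
  rewrite ex_EFin; last by do 2 apply: Lfun1D => //.
  rewrite (exD (Lfun1D l12 (lc _)) (lc _)) (exD l12 (lc _)) !ex_cst.
  by rewrite /tracking_error (meanB ax ay).
rewrite /cost (eq_bigr (fun k : 'I_N => (stage u k)%:E)); last first.
  by move=> k _; exact: stages.
by rewrite sumEFin -addeA terminal -EFinD telescope.
Qed.

Notation opt u k := (optimal_control P K rho M k (sx u k) (sy k)).

Lemma optimal_feedback_exists :
  exists u, linear_feedback P K w v zx zy N u /\ forall k t, u k t = opt u k t.
Proof.
pose W1i k := invmx (W1 K M k); pose W2i k := invmx (W2 K M k).
(* Expanding x - E x moves part of the first gain to E x: its coefficient becomes the difference of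
   the fluctuation and mean gains. The same holds for y. *)
have [u uE] := feedback_exists
  (fun k => - (W1i k *m (H1 K M k)^T))
  (fun k => W1i k *m (H1 K M k)^T - W2i k *m (H2 K M k)^T)
  (fun k => - (W1i k *m (H3 K rho M k)^T))
  (fun k => W1i k *m (H3 K rho M k)^T - W2i k *m (H4 K rho M k)^T).
exists u; split; first by do 4 eexists; move=> k _ t; exact: uE.
move=> k t; rewrite uE /optimal_control -/(W1i k) -/(W2i k).
have zmodE (a b c e f g : 'cV[R]_m) :
    - a + (b - c) - e + (f - g) = - (a - b) - c - (e - f) - g.
  by apply/colP => i; rewrite !mxE; ring.
by rewrite !mulmxBr !mulNmx !mulmxBl; exact: zmodE.
Qed.

Lemma cost_ge u : linear_feedback P K w v zx zy N u ->
  ((value P M 0 zx zy)%:E <= cost P K w v zx zy N u)%E.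
Proof.
move=> fu; rewrite (cost_gap fu) lee_fin lerDl sumr_ge0// => k _.
by apply: gap_ge0; [exact: W1_pdN | exact: W2_pdN].
Qed.

Lemma cost_optimal u : linear_feedback P K w v zx zy N u ->
  (forall k t, u k t = opt u k t) ->
  cost P K w v zx zy N u = (value P M 0 zx zy)%:E.
Proof.
move=> fu uE; rewrite (cost_gap fu) big1 ?addr0// => k _.
rewrite (funext (uE k)).
exact: (gap_optimal_control _ _ _ _ (adapted_state_x fu (ltnW (ltn_ord k)))
  (adapted_state_y (ltnW (ltn_ord k)))).
Qed.

(** All gaps are nonnegative with sum at most zero, so each is zero. The formula obtained is
    evaluated along the trajectory of u itself, not yet along a common one. *)
Lemma cost_optimal_ae u : linear_feedback P K w v zx zy N u ->
  (cost P K w v zx zy N u <= (value P M 0 zx zy)%:E)%E ->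
  forall k, (k < N)%N -> {ae P, forall t, u k t = opt u k t}.
Proof.
move=> fu; rewrite (cost_gap fu) lee_fin gerDl => gap_le0 k kN.
have gap0 (j : 'I_N) : 0 <= gapk u j.
  by apply: gap_ge0; [exact: W1_pdN | exact: W2_pdN].
have /psumr_eq0P gapE : \sum_(j < N) gapk u j = 0.
  by apply/eqP; rewrite eq_le gap_le0 sumr_ge0.
have ax := adapted_state_x fu (ltnW kN).
apply: (gap_eq0 (W1_pdN kN) (W2_pdN kN) ax (adapted_state_y (ltnW kN))).
  exact: linear_feedback_adapted.
by have := gapE (fun j _ => gap0 j) (Ordinal kN) isT.
Qed.

(** Forward induction: almost surely equal states have equal means, so the same formula gives almost
    surely equal controls with equal means, and these produce almost surely equal next states. *)
Lemma ae_eq_optimal u u' :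
    linear_feedback P K w v zx zy N u -> linear_feedback P K w v zx zy N u' ->
    (forall k, (k < N)%N -> {ae P, forall t, u k t = opt u k t}) ->
    (forall k, (k < N)%N -> {ae P, forall t, u' k t = opt u' k t}) ->
  forall k, (k < N)%N -> {ae P, forall t, u k t = u' k t}.
Proof.
move=> fu fu' uE uE'.
have control k : (k < N)%N -> {ae P, forall t, sx u k t = sx u' k t} ->
    {ae P, forall t, u k t = u' k t}.
  move=> kN; have ax := adapted_state_x fu (ltnW kN).
  have ax' := adapted_state_x fu' (ltnW kN) => xE.
  have mE := ae_eq_mean (G_sub (k := k)) ax ax' xE.
  apply: filterS3 xE (uE k kN) (uE' k kN) => t xE -> ->.
  by rewrite /optimal_control xE mE.
suff state k : (k <= N)%N -> {ae P, forall t, sx u k t = sx u' k t}.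
  by move=> k kN; apply: control => //; apply: state; exact: ltnW.
elim: k => [_|k ih kN]; first exact: aeW.
have xE := ih (ltnW kN); have cE := control k kN xE.
have ax := adapted_state_x fu (ltnW kN).
have ax' := adapted_state_x fu' (ltnW kN).
have mE := ae_eq_mean (G_sub (k := k)) ax ax' xE.
have mcE := ae_eq_mean (G_sub (k := k)) (linear_feedback_adapted fu kN ax)
  (linear_feedback_adapted fu' kN ax') cE.
apply: filterS2 xE cE => t /= -> ->.
by rewrite mE mcE.
Qed.

End Trajectories.

Theorem theorem4p1 (R : realType) (d : measure_display) (T : measurableType d)
    (P : probability T R) (n m N : nat) (K : coefficients R n m) (rho : R)
    (w v : nat -> {RV P >-> R}) (M : riccati_matrices R n)
    (N_gt0 : (0 < N)%N)
    (symQ : forall k, (k <= N)%N ->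
       cQ K k \is symmetricmx /\ cQb K k \is symmetricmx)
    (symR : forall k, (k < N)%N ->
       cR K k \is symmetricmx /\ cRb K k \is symmetricmx)
    (Q_psd : forall k, (k <= N)%N -> psd (cQ K k) /\ psd (cQ K k + cQb K k))
    (R_pd : forall k, (k < N)%N -> pd (cR K k) /\ pd (cR K k + cRb K k))
    (M_riccati : riccati_system K rho M N) :
  (forall k, (k < N)%N -> W1 K M k \in unitmx /\ W2 K M k \in unitmx)
  /\
  (forall zx zy : T -> 'cV[R]_n,
     square_integrable P zx -> square_integrable P zy ->
     noise_model P N rho zx zy w v ->
     exists uo : nat -> T -> 'cV[R]_m,
       let xo := state_x P K w zx uo in
       let y := state_y P K v zy in
       [/\ forall k, (k < N)%N -> forall t,
             uo k t =
               - (invmx (W1 K M k) *m (H1 K M k)^T *m (xo k t - mean P (xo k)))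
               - invmx (W2 K M k) *m (H2 K M k)^T *m mean P (xo k)
               - invmx (W1 K M k) *m (H3 K rho M k)^T *m (y k t - mean P (y k))
               - invmx (W2 K M k) *m (H4 K rho M k)^T *m mean P (y k),
           minimizes_cost P K w v zx zy N uo
         & forall u, minimizes_cost P K w v zx zy N u ->
             forall k, (k < N)%N -> {ae P, forall t, u k t = uo k t}])
  /\
  (forall k, (k <= N)%N -> psd (Px M k) /\ psd (Px M k + Pxb M k)).
Proof.
have Ppsd k := riccati_psd Q_psd R_pd M_riccati (k := k).
split; last split.
- move=> k kN; have [p1 p2] := Ppsd _ kN.
  by split; apply: pd_unitmx; [exact: (W1_pd R_pd kN) | exact: (W2_pd R_pd kN)].
- move=> zx zy zx_L2 zy_L2 nm.
  have mw k : measurable_fun setT (w k) by [].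
  have mv k : measurable_fun setT (v k) by [].
  have [uo [fuo uoE]] := optimal_feedback_exists P K rho N w v zx zy M.
  have costo := cost_optimal mw mv zx_L2 zy_L2 nm Q_psd R_pd M_riccati fuo uoE.
  exists uo; split.
  + by move=> k _ t; exact: uoE.
  + split=> // u fu; rewrite costo.
    exact: (cost_ge mw mv zx_L2 zy_L2 nm Q_psd R_pd M_riccati).
  (* Minimality tested against [uo] bounds the cost of u by the value at 0, which forces every gap
     of u to vanish. *)
  + move=> u [fu /(_ _ fuo)]; rewrite costo => cost_le.
    apply: (ae_eq_optimal mw mv zx_L2 zy_L2 nm fu fuo).
      exact: (cost_optimal_ae mw mv zx_L2 zy_L2 nm Q_psd R_pd M_riccati).
    by move=> k _; exact: aeW.
- by move=> k kN; exact: Ppsd.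
Qed.
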